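(* Let $w\in A_1$. For $p\in[1,\infty)$ the spaces $\mathrm{BMO}_{\mathcal{A}}^p(X,w)$ coincide and their norms are equivalent; that is, for all $p,q\in[1,\infty)$ one has $\mathrm{BMO}_{\mathcal{A}}^p(X,w)=\mathrm{BMO}_{\mathcal{A}}^q(X,w)$ and there is a constant $C\ge1$ such that $C^{-1}\|f\|_{\mathrm{BMO}_{\mathcal{A}}^q(X,w)}\le\|f\|_{\mathrm{BMO}_{\mathcal{A}}^p(X,w)}\le C\|f\|_{\mathrm{BMO}_{\mathcal{A}}^q(X,w)}$ for all $f$ in this common space.
   Context: Setting. $(X,d)$ is a metric space with a nonnegative Borel measure $\mu$ that is doubling: there is $C\ge 1$ with $\mu(B(x,2r))\le C\mu(B(x,r))<\infty$ for all $x\in X$, $r>0$, where $B(x,r)=\{y:d(x,y)<r\}$; balls have positive measure. Write $V(E)=\mu(E)$, $V(x,r)=\mu(B(x,r))$; for a ball $B$, $r_B$ is its radius. Weights. A weight $w$ is a nonnegative locally integrable function on $X$ (not a.e. zero); $w(E)=\int_E w\,d\mu$. $w\in A_1$ means there is $C$ such that for every ball $B$, $\frac1{V(B)}\int_B w\,d\mu\le C\,w(x)$ for a.e. $x\in B$. The family $\{\mathcal{A}_t\}_{t>0}$. Each $\mathcal{A}_t$ is an integral operator $\mathcal{A}_tf(x)=\int_X a_t(x,y)f(y)\,d\mu(y)$, with kernel satisfying, for fixed constants $m\ge 2$, $C,c>0$, $$|a_t(x,y)|\le \frac{C}{V(x,t^{1/m})}\exp\Big(-c\,\frac{d(x,y)^{m/(m-1)}}{t^{1/(m-1)}}\Big)\quad\text{for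 all } t>0,\ x,y\in X,$$ and the operators commute: $\mathcal{A}_s\mathcal{A}_t=\mathcal{A}_t\mathcal{A}_s$ for all $s,t>0$ (no semigroup property is assumed). The class $\mathcal{M}$. For $x_0\in X$, $\beta>0$, $f\in L^1_{loc}(X)$ is of type $(x_0,\beta)$ if $\int_X \frac{|f(x)|^2}{(1+d(x_0,x))^{\beta}V(x_0,1+d(x_0,x))}\,d\mu(x)<\infty$. $\mathcal{M}$ is the set of all functions of type $(x_0,\beta)$ for some $x_0\in X$, $0<\beta<\infty$. The operators $\mathcal{A}_t$ act on $\mathcal{M}$ by the integral $\mathcal{A}_tf(x)=\int_X a_t(x,y)f(y)\,d\mu(y)$. For $w\in A_1$ and $p\in[1,\infty)$, $\mathrm{BMO}^p_{\mathcal{A}}(X,w)$ is the set of $f\in\mathcal{M}$ with $$\|f\|_{\mathrm{BMO}^p_{\mathcal{A}}(X,w)}=\sup_B\Big(\frac1{w(B)}\int_B|(I-\mathcal{A}_{t_B})f(x)|^p\,w^{1-p}(x)\,d\mu(x)\Big)^{1/p}<\infty,\qquad t_B=r_B^m,$$ the supremum being over all balls $B$. (These ''norms'' are seminorms, the spaces being understood modulo $\{f\in\mathcal{M}:\mathcal{A}_tf=f\text{ a.e. for all }t>0\}$.) *)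

(* Defs.v *)
From HB Require Import structures.
From mathcomp Require Import all_boot all_order all_algebra.
From mathcomp Require Import complex.
From mathcomp Require Import all_classical all_reals all_analysis.

Set Implicit Arguments.
Unset Strict Implicit.
Unset Printing Implicit Defensive.

Import Order.TTheory GRing.Theory Num.Theory.
Import numFieldNormedType.Exports.

Local Open Scope classical_set_scope.
Local Open Scope ring_scope.
Local Open Scope complex_scope.

HB.mixin Record isBorelMetric (R : numDomainType) (d : measure_display) X
    & Metric R X & Measurable d X := {
  borel_measurableE : (measurable : set (set X)) = <<s open >>
}.

#[short(type="borelMetricType")]
HB.structure Definition BorelMetric (R : numDomainType) (d : measure_display) :=
  { X of Metric R X & Measurable d X & isBorelMetric R d X }.

Notation cabs := ComplexField.Normc.normc.

Section complex_valued_functions.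
Context {d : measure_display} {T : measurableType d} {R : realType}.

Definition cmeasurable (f : T -> R[i]) : Prop :=
  measurable_fun setT (fun x => complex.Re (f x)) /\
  measurable_fun setT (fun x => complex.Im (f x)).

(* Meaningful when f is integrable; Rintegral has junk values otherwise. *)
Definition cintegral (mu : {measure set T -> \bar R}) (f : T -> R[i]) : R[i] :=
  (\int[mu]_x complex.Re (f x)) +i* (\int[mu]_x complex.Im (f x)).

End complex_valued_functions.

Section weighted_BMO.
Context {R : realType} {d : measure_display} {X : borelMetricType R d}.
Variable mu : {measure set X -> \bar R}.

Definition doubling : Prop :=
  (forall x r, 0 < r -> (0 < mu (ball x r))%E) /\
  exists2 C : R, 1 <= C & forall x r, 0 < r ->
    (mu (ball x (2 * r)) <= C%:E * mu (ball x r))%E /\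
    (C%:E * mu (ball x r) < +oo)%E.

(* Finite for r > 0 under [doubling], so that fine loses nothing. *)
Definition vol (x : X) (r : R) : R := fine (mu (ball x r)).

(* For A_1 weights and for functions in the class M below, this is equivalent
   to integrability near each point. *)
Definition locally_integrable_on_balls (f : X -> R[i]) : Prop :=
  cmeasurable f /\
  forall x r, 0 < r -> mu.-integrable (ball x r) (fun y => (cabs (f y))%:E).

Definition weight (w : X -> R) : Prop :=
  [/\ forall x, 0 <= w x,
      locally_integrable_on_balls (fun x => (w x)%:C) &
      ~ {ae mu, forall x, w x = 0}].

Definition wmeas (w : X -> R) (E : set X) : \bar R :=
  (\int[mu]_(x in E) (w x)%:E)%E.

Definition A1 (w : X -> R) : Prop :=
  weight w /\
  exists C : R, forall x r, 0 < r ->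
    {ae mu, forall y, ball x r y ->
      (((vol x r)^-1)%:E * wmeas w (ball x r) <= (C * w y)%:E)%E}.

Definition of_type (x0 : X) (beta : R) (f : X -> R[i]) : Prop :=
  locally_integrable_on_balls f /\
  (\int[mu]_x (cabs (f x) ^+ 2 /
     ((1 + mdist x0 x) `^ beta * vol x0 (1 + mdist x0 x)))%:E < +oo)%E.

Definition classM : set (X -> R[i]) :=
  [set f | exists x0 beta, 0 < beta /\ of_type x0 beta f].

Variables (a : R -> X -> X -> R[i]) (m : R).

Definition opA (t : R) (f : X -> R[i]) (x : X) : R[i] :=
  cintegral mu (fun y => a t x y * f y).

(* Product sigma-algebra on X * X. *)
Definition jointly_measurable : Prop :=
  forall t, 0 < t -> cmeasurable (fun z : X * X => a t z.1 z.2).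

Definition gaussian_bound : Prop :=
  exists C c : R, [/\ 0 < C, 0 < c & forall t x y, 0 < t ->
    cabs (a t x y) <= C / vol x (t `^ m^-1) *
      expR (- (c * (mdist x y `^ (m / (m - 1)) / t `^ (m - 1)^-1)))].

(* Equality of operators on M, functions being identified mu-a.e. *)
Definition commuting : Prop :=
  forall s t f, 0 < s -> 0 < t -> classM f ->
    {ae mu, forall x, opA s (opA t f) x = opA t (opA s f) x}.

Variable w : X -> R.

(* A ball enters with a chosen centre and radius. For w in A_1, w > 0 a.e.,
   so the convention for 0 `^ (1 - p) is irrelevant. *)
Definition BMO_norm (p : R) (f : X -> R[i]) : \bar R :=
  ereal_sup [set z | exists (x : X) (r : R), 0 < r /\
    z = ((((fine (wmeas w (ball x r)))^-1)%:E *
          \int[mu]_(y in ball x r)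
            (cabs (f y - opA (r `^ m) f y) `^ p * w y `^ (1 - p))%:E)
         `^ p^-1)%E].

Definition BMO (p : R) : set (X -> R[i]) :=
  [set f | classM f /\ (BMO_norm p f < +oo)%E].

End weighted_BMO.

(* Main.v *)
Require Import Defs.
From HB Require Import structures.
From mathcomp Require Import all_boot all_order all_algebra.
From mathcomp Require Import complex.
From mathcomp Require Import all_classical all_reals all_analysis.
From mathcomp Require Import measurable_realfun ring lra.

Set Implicit Arguments.
Unset Strict Implicit.
Unset Printing Implicit Defensive.

Import Order.TTheory GRing.Theory Num.Theory.
Import numFieldNormedType.Exports.

Local Open Scope classical_set_scope.
Local Open Scope ring_scope.
Local Open Scope complex_scope.

(** Write g_r for the modulus of f - A_(r^m) f, nu for the measure w dmu, and N
    for the L^1 seminorm of f: the integral of g_r over any ball of radius r is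
    at most N nu(B). Relative to nu, the p-th power of the L^p average over B is
    the nu-average of (g_r / w)^p, so everything rests on a John-Nirenberg
    inequality: the distribution function of g_r / w on a ball of radius r
    decays exponentially at scale N, uniformly in the ball
    ([osc_distribution_decay]).

    The family has no semigroup property, but
    A_t f - A_s f = A_t (f - A_s f) - A_s (f - A_t f) whenever A_s and A_t
    commute ([opA_difference_le]). The Gaussian bound turns each term into an
    average at the scale of the operator ([kernel_integral_le]), and A_1 turns
    averages into pointwise bounds by w, because nu(B(x, r)) / mu(B(x, r)) is at
    most a multiple of w almost everywhere ([A1_ratio]). Hence, if the averages
    of g_r on all balls of radius at least s around the points of a ball B' of
    radius s <= r are at most L >= N, then g_r <= g_s + C L w almost everywhere
    on B' ([opA_difference_controlled]).

    The decay follows by a stopping argument. Given a ball B of radius r, stop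
    at the largest dyadic scale at which the average of g_r around a point of B
    exceeds A N. Where no stopping occurs, g_r is at most a multiple of A N w
    ([small_averages_ae]). On a stopping ball of radius s the above comparison
    replaces g_r by g_s at the price of a multiple of A N w, after which the
    estimate already known for g_s applies. A Vitali selection makes the
    stopping balls disjoint, so their total mass is O(nu(B) / A), and A is chosen
    to make it an arbitrarily small fraction eps of nu(B).

    With eps = 2^(-k-1), k >= q, summing the layers n T N w < g_r <= (n+1) T N w
    bounds the L^q seminorm by a multiple of N ([osc_pow_le_of_osc_le]); the
    L^1 seminorm is bounded by twice the L^p one by an elementary pointwise
    inequality ([osc_le_of_osc_pow_le]). *)

(** * Covering by balls *)

Section covering.
Context {R : realType} {d : measure_display} {X : borelMetricType R d}.
Implicit Types (x y z : X) (r s : R) (S : set X) (rad : X -> R).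

Lemma in_ballE x r y : ball x r y = (mdist x y < r).
Proof. by rewrite ballEmdist. Qed.

Lemma sub_ball x y r s : mdist y x + r <= s -> ball x r `<=` ball y s.
Proof.
move=> h z; rewrite !in_ballE => xz.
by have := metric_triangle y x z; lra.
Qed.

Lemma ball_measurable x r : measurable (ball x r).
Proof.
rewrite borel_measurableE; apply: sub_sigma_algebra.
rewrite openE => y xy; rewrite /interior.
have e0 : 0 < r - mdist x y by move: xy; rewrite in_ballE; lra.
apply: filterS (nbhsx_ballx y _ e0).
by apply: sub_ball; lra.
Qed.

Lemma open_measurable_borel (U : set X) : open U -> measurable U.
Proof. by move=> oU; rewrite borel_measurableE; exact: sub_sigma_algebra. Qed.

Lemma open_metric_ball x r : open (ball x r).
Proof.
rewrite openE => y xy; rewrite /interior.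
have e0 : 0 < r - mdist x y by move: xy; rewrite in_ballE; lra.
by apply: filterS (nbhsx_ballx y _ e0); apply: sub_ball; lra.
Qed.

(** The greedy choice of the largest remaining ball. The dilation factor is 4
    rather than the usual 3 because doubling is applied to powers of two. *)
Lemma finite_vitali rad (t : seq X) : {in t, forall x, 0 < rad x} ->
  exists u : seq X, [/\ uniq u, {subset u <= t},
    trivIset [set` u] (fun x => ball x (rad x)) &
    forall x, x \in t -> exists2 y, y \in u &
      ball x (rad x) `<=` ball y (4 * rad y)].
Proof.
have [n] := ubnP (size t); elim: n t => // n IH [|a0 t'] tn tpos.
  by exists [::]; split => //= x; rewrite inE.
set t := a0 :: t' in tn tpos *.
have [a at_ amax] : exists2 a, a \in t & {in t, forall x, rad x <= rad a}.
  have : t != [::] by [].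
  elim: (t) => // b [|c l] IHl _.
    by exists b; rewrite ?mem_head// => x; rewrite inE => /eqP->.
  have [//|a al amax] := IHl.
  have [ab|ba] := leP (rad a) (rad b).
    exists b; first exact: mem_head.
    move=> x; rewrite inE => /predU1P[->//|/amax xa]; exact: le_trans ab.
  exists a; first by rewrite inE al orbT.
  by move=> x; rewrite inE => /predU1P[->|/amax//]; exact: ltW.
pose q y := `[< ball y (rad y) `&` ball a (rad a) = set0 >].
have qa : ~~ q a.
  apply/negP => /asboolP; rewrite setIid -subset0 => /(_ a); apply.
  by rewrite in_ballE mdistxx tpos.
have [||u [uu us ut uc]] := IH [seq y <- t | q y].
- rewrite size_filter -ltnS (leq_trans _ tn)// ltnS.
  rewrite -(count_predC q t) -[X in (X < _)%N]addn0 ltn_add2l -has_count.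
  by apply/hasP; exists a.
- by move=> x; rewrite mem_filter => /andP[_ /tpos].
have ausep y : y \in u -> ball y (rad y) `&` ball a (rad a) = set0.
  by move/us; rewrite mem_filter => /andP[/asboolP].
exists (a :: u); split.
- rewrite /= uu andbT; apply/negP => /us.
  by rewrite mem_filter (negbTE qa).
- move=> x; rewrite inE => /predU1P[->//|/us].
  by rewrite mem_filter => /andP[].
- move=> x y /=; rewrite !inE => /predU1P[->|xu] /predU1P[->//|yu].
  + by rewrite setIC ausep// => /set0P; rewrite eqxx.
  + by rewrite ausep// => /set0P; rewrite eqxx.
  + exact: ut.
- move=> x xt; have [/asboolP qx|qx] := boolP (q x).
    have [|y yu xy] := uc x; first by rewrite mem_filter xt andbT; apply/asboolP.
    by exists y => //; rewrite inE yu orbT.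
  exists a; first exact: mem_head.
  move: qx => /asboolP/eqP/set0P[z [/= xz az]].
  apply: sub_ball; move: xz az; rewrite !in_ballE => xz az.
  have := metric_triangle a z x; rewrite (metric_sym z x).
  have := amax _ xt; have := tpos _ at_; lra.
Qed.

Lemma measure_disjoint_seq (kappa : {measure set X -> \bar R}) (t : seq X)
    (F : X -> set X) : uniq t -> (forall y, measurable (F y)) ->
  trivIset [set` t] F ->
  kappa (\bigcup_(y in [set` t]) F y) = (\sum_(y <- t) kappa (F y))%E.
Proof.
move=> ut mF tF; rewrite (fsbig_seq _ _ ut).
exact: (@measure_fin_bigcup _ _ _ kappa _ [set` t] F (finite_seq _) tF
  (fun y _ => mF y)).
Qed.

Lemma sum_disjoint_le (kappa : {measure set X -> \bar R}) (t : seq X)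
    (F : X -> set X) (E : set X) : uniq t -> (forall y, measurable (F y)) ->
  measurable E -> trivIset [set` t] F -> (forall y, y \in t -> F y `<=` E) ->
  (\sum_(y <- t) kappa (F y) <= kappa E)%E.
Proof.
move=> ut mF mE tF FE; rewrite -measure_disjoint_seq//.
apply: le_measure; rewrite ?inE//.
- by apply: fin_bigcup_measurable.
- by move=> z [y /= yt]; exact: FE.
Qed.

Section doubling_balls.
Variables (mu : {measure set X -> \bar R}) (mu_dbl : doubling mu).

Lemma volE x r : 0 < r -> mu (ball x r) = (vol mu x r)%:E.
Proof.
case: mu_dbl => p [C C1 h] r0; rewrite /vol fineK// ge0_fin_numE//.
have [_] := h x r r0; have := measure_ge0 mu (ball x r).
case: (mu (ball x r)) => [a _ _|_|//]; first by rewrite ltry.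
by rewrite gt0_muley// lte_fin; lra.
Qed.

Lemma vol_gt0 x r : 0 < r -> 0 < vol mu x r.
Proof. by move=> r0; rewrite -lte_fin -volE//; apply: mu_dbl.1. Qed.

Lemma le_vol x y r s : 0 < r -> 0 < s -> mdist y x + r <= s ->
  vol mu x r <= vol mu y s.
Proof.
move=> r0 s0 h; rewrite -lee_fin -!volE//.
by apply: le_measure; rewrite ?inE; [exact: ball_measurable..|exact: sub_ball].
Qed.

Lemma vol_doubling : exists2 D : R, 1 <= D &
  forall n x r, 0 < r -> vol mu x (2 ^+ n * r) <= D ^+ n * vol mu x r.
Proof.
case: mu_dbl => p [C C1 h]; exists C => // n x r r0.
elim: n => [|n IH]; first by rewrite !expr0 !mul1r.
have r'0 : 0 < 2 ^+ n * r by rewrite mulr_gt0// exprn_gt0.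
have := (h x (2 ^+ n * r) r'0).1; rewrite !volE ?mulr_gt0//.
rewrite -EFinM lee_fin mulrA -exprS => /le_trans; apply.
by rewrite exprS -mulrA ler_wpM2l//; lra.
Qed.

(** A maximal family of r-separated points of a ball; it is finite because the
    disjoint half-balls all carry a fixed fraction of the mass of the ball. *)
Lemma finite_net x r R0 : 0 < r -> 0 < R0 -> exists t : seq X,
  [/\ uniq t, {in t, forall y, ball x R0 y},
      trivIset [set` t] (fun y => ball y (r / 2)) &
      forall z, ball x R0 z -> exists2 y, y \in t & ball y r z].
Proof.
move=> r0 R00.
pose sep (t : seq X) := [/\ uniq t, {in t, forall y, ball x R0 y} &
  trivIset [set` t] (fun y => ball y (r / 2))].
pose P n := `[< exists2 t, sep t & size t = n >].
have P0 : exists n, P n.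
  exists 0%N; apply/asboolP; exists [::] => //; split => //.
have r20 : 0 < r / 2 by lra.
have [D D1 dbl] := vol_doubling.
have [k kr] : exists k, 2 * R0 <= 2 ^+ k * (r / 2).
  exists (Num.bound (2 * R0 / (r / 2))).
  by rewrite -ler_pdivrMr// ltW// upper_nthrootP.
(* the mass carried by every half-ball of the family *)
pose delta := vol mu x R0 / D ^+ k.
have Dk : 0 < D ^+ k by rewrite exprn_gt0//; lra.
have delta0 : 0 < delta by rewrite divr_gt0// vol_gt0.
pose M := Num.bound (vol mu x (R0 + r) / delta).
have PM n : P n -> (n <= M)%N.
  move=> /asboolP[t [ut tb tt] <-].
  have : (\sum_(y <- t) mu (ball y (r / 2)) <= mu (ball x (R0 + r)))%E.
    apply: sum_disjoint_le => //.
    - by move=> y; exact: ball_measurable.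
    - exact: ball_measurable.
    by move=> y /tb; rewrite in_ballE => h; apply: sub_ball; lra.
  rewrite volE; last by lra.
  have : (\sum_(y <- t) delta%:E <= \sum_(y <- t) mu (ball y (r / 2)))%E.
    rewrite big_seq [leRHS]big_seq; apply: lee_sum => y /tb; rewrite in_ballE => h.
    rewrite volE// lee_fin ler_pdivrMr// mulrC (le_trans _ (dbl _ _ _ _))//.
    apply: le_vol; [by []|by rewrite mulr_gt0// exprn_gt0|].
    by rewrite metric_sym; lra.
  move=> /le_trans /[apply]; rewrite sumEFin lee_fin big_const_seq count_predT.
  rewrite iter_addr addr0 -mulr_natr mulrC -ler_pdivlMr// => h.
  rewrite -(ler_nat R) (le_trans h)// ltW// archi_boundP//.
  by rewrite divr_ge0// ltW// vol_gt0//; lra.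
case: (ex_maxnP P0 PM) => i /asboolP[t [ut tb tt] ti] imax.
exists t; split => // z xz; apply: contrapT => nz.
have far y : y \in t -> r <= mdist y z.
  by move=> yt; rewrite leNgt; apply/negP => h; apply: nz; exists y; rewrite ?in_ballE.
have zt : z \notin t by apply/negP => /far; rewrite mdistxx; lra.
have sepz y : y \in t -> ball z (r / 2) `&` ball y (r / 2) = set0.
  move=> yt; rewrite -subset0 => u [] /=; rewrite !in_ballE => zu yu.
  have := far _ yt; have := metric_triangle y u z.
  by rewrite (metric_sym u z); lra.
have : P i.+1.
  apply/asboolP; exists (z :: t); last by rewrite /= ti.
  split.
  - by rewrite /= zt.
  - by move=> y; rewrite inE => /predU1P[->//|/tb].
  - move=> y1 y2 /=; rewrite !inE => /predU1P[->|xu] /predU1P[->//|yu].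
    + by rewrite sepz// => /set0P; rewrite eqxx.
    + by rewrite setIC sepz// => /set0P; rewrite eqxx.
    + exact: tt.
by move/imax; rewrite ltnn.
Qed.

(** The union over n of nets of mesh 1/(n+1) of the balls of radius n+1. *)
Lemma dense_sequence (x0 : X) : exists e : nat -> X,
  forall x r, 0 < r -> exists n, mdist (e n) x < r.
Proof.
have invS (n : nat) : 0 < n.+1%:R^-1 :> R by rewrite invr_gt0.
have posS (n : nat) : 0 < n.+1%:R :> R by [].
pose t n := sval (cid (finite_net x0 (invS n) (posS n))).
have ht n z : ball x0 n.+1%:R z -> exists2 y, y \in t n & ball y n.+1%:R^-1 z.
  by rewrite /t; case: cid => /= u [_ _ _]; exact.
pose e k := if @unpickle (nat * nat)%type k is Some (n, i) then nth x0 (t n) i else x0.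
exists e => x r r0.
pose n := maxn (Num.bound (mdist x0 x)) (Num.bound r^-1).
have xn : ball x0 n.+1%:R x.
  rewrite in_ballE (lt_le_trans (archi_boundP _)) ?mdist_ge0//.
  by rewrite ler_nat leqW// leq_maxl.
have rn : n.+1%:R^-1 < r.
  rewrite -[ltRHS]invrK ltf_pV2 ?posrE ?invr_gt0//.
  have /lt_le_trans : r^-1 < (Num.bound r^-1)%:R.
    by apply: archi_boundP; rewrite invr_ge0 ltW.
  by apply; rewrite ler_nat leqW// leq_maxr.
have [y yt yx] := ht n _ xn.
exists (pickle (n, index y (t n))).
by rewrite /e pickleK nth_index//; move: yx; rewrite in_ballE => /lt_trans; apply.
Qed.

(** The Lindelof property: choose one ball of the family above each ball with
    centre in the dense sequence and radius 1/(k+1), whenever there is one. *)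
Lemma countable_subcover S rad (x0 : X) : S x0 ->
  exists2 c : nat -> X, (forall n, S (c n)) &
    \bigcup_(x in S) ball x (rad x) `<=` \bigcup_n ball (c n) (rad (c n)).
Proof.
move=> Sx0; have [e he] := dense_sequence x0.
pose Q (nk : nat * nat) x :=
  S x /\ ball (e nk.1) nk.2.+1%:R^-1 `<=` ball x (rad x).
pose c j := if @unpickle (nat * nat)%type j is Some nk then
  (if pselect (exists x, Q nk x) is left h then sval (cid h) else x0) else x0.
have Sc j : S (c j).
  rewrite /c; case: unpickle => [nk|//]; case: pselect => [h|//].
  by case: cid => /= y [].
exists c => // z [x Sx] xz.
have e0 : 0 < rad x - mdist x z by move: xz; rewrite in_ballE; lra.
pose dl := (rad x - mdist x z) / 2.
have dl0 : 0 < dl by rewrite /dl; lra.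
pose k := Num.bound dl^-1.
have kd : k.+1%:R^-1 < dl.
  rewrite -[ltRHS]invrK ltf_pV2 ?posrE ?invr_gt0//.
  have /lt_le_trans : dl^-1 < (Num.bound dl^-1)%:R.
    by apply: archi_boundP; rewrite invr_ge0 ltW.
  by apply; rewrite ler_nat.
have [n nz] := he z k.+1%:R^-1 ltac:(by rewrite invr_gt0).
have hQ : exists x, Q (n, k) x.
  exists x; split => //=; apply: sub_ball.
  have := metric_triangle x z (e n); rewrite (metric_sym z).
  by move: nz kd; rewrite /dl; move: (k.+1%:R^-1) => q; lra.
exists (pickle (n, k)) => //; rewrite /c pickleK.
case: pselect => // h; case: cid => /= y [Sy]; apply.
by rewrite in_ballE.
Qed.

(** Vitali's lemma in the form in which it is used: a set covered by balls is
    controlled by the fourfold dilations of disjoint ones, and only finite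
    disjoint subfamilies have to be tested. *)
Lemma vitali_le (kappa : {measure set X -> \bar R}) (E : set X) S rad M :
  measurable E -> (forall x, S x -> 0 < rad x) ->
  E `<=` \bigcup_(x in S) ball x (rad x) ->
  (forall t : seq X, uniq t -> (forall x, x \in t -> S x) ->
    trivIset [set` t] (fun x => ball x (rad x)) ->
    (\sum_(x <- t) kappa (E `&` ball x (4 * rad x)) <= M)%E) ->
  (kappa E <= M)%E.
Proof.
move=> mE radpos Ecov hM.
have M0 : (0 <= M)%E by have := hM [::] isT; rewrite big_nil; apply.
have [[x0 Sx0]|noS] := pselect (exists x, S x); last first.
  suff -> : E = set0 by rewrite measure0.
  rewrite -subset0 => z /Ecov[x Sx _]; apply: noS; by exists x.
have [c Sc ccov] := countable_subcover rad Sx0.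
pose F n := E `&` \bigcup_(i < n) ball (c i) (rad (c i)).
have mF n : measurable (F n).
  apply: measurableI => //; apply: bigcup_measurable => i _; exact: ball_measurable.
have EF : E = \bigcup_n F n.
  apply/seteqP; split => [z Ez|z [n _ []//]].
  have [i _ iz] := ccov _ (Ecov _ Ez).
  by exists i.+1 => //; split => //; exists i => //=.
have ndF : nondecreasing_seq F.
  move=> m n mn; apply/subsetPset => z [Ez [i /= im iz]]; split => //.
  by exists i => //=; exact: leq_trans mn.
have cvF : kappa \o F @ \oo --> kappa E.
  rewrite EF; apply: nondecreasing_cvg_mu => //.
  by rewrite -EF.
rewrite -(cvg_lim _ cvF)//; apply: lime_le; first by apply/cvg_ex; exists (kappa E).
near=> n => /=.
pose l := [seq c i | i <- iota 0 n].
have lS x : x \in l -> S x by move=> /mapP[i _ ->].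
have [|u [uu ul ut uc]] := @finite_vitali rad l.
  by move=> x /lS/radpos.
have mEb x : measurable (E `&` ball x (4 * rad x)).
  by apply: measurableI => //; exact: ball_measurable.
apply: (le_trans _ (hM u uu _ ut)); last by move=> x /ul/lS.
rewrite (fsbig_seq _ _ uu); apply: content_sub_fsum => //.
  move=> z [Ez [i /= im iz]].
have [|y yu yz] := uc (c i); first by apply: map_f; rewrite mem_iota.
by exists y => //; split => //; exact: yz.
Unshelve. all: by end_near. Qed.

End doubling_balls.
End covering.


(** * Outer regularity of finite Borel measures *)

Section outer_regularity.
Context {R : realType} {d : measure_display} {X : borelMetricType R d}.
Variable kappa : {measure set X -> \bar R}.
Hypothesis kfin : (kappa setT < +oo)%E.

Let small_tail (D : (set X)^nat) (e : R) : (forall n, measurable (D n)) ->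
  (forall m n, (m <= n)%N -> D n `<=` D m) -> \bigcap_n D n = set0 ->
  0 < e -> exists n, (kappa (D n) <= e%:E)%E.
Proof.
move=> mD ndD D0 e0.
have cv : kappa \o D @ \oo --> 0%E.
  rewrite -[X in _ --> X](measure0 kappa) -D0; apply: nonincreasing_cvg_mu => //.
  - by rewrite (le_lt_trans _ kfin)// le_measure// inE.
  - exact: bigcap_measurable.
  - by move=> m n mn; apply/subsetPset; exact: ndD.
have : nbhs 0%E [set z : \bar R | (z < e%:E)%E].
  by apply: open_nbhs_nbhs; split; [exact: open_ereal_lt_ereal|rewrite /= lte_fin].
by move/cv => [n _ /(_ n (leqnn n))] /= /ltW; exists n.
Qed.

Let good (E : set X) := forall e, 0 < e -> exists F U : set X,
  [/\ closed F, open U, F `<=` E, E `<=` U & (kappa (U `\` F) <= e%:E)%E].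

Let good_open U : open U -> good U.
Proof.
move=> oU e e0.
(* the points of U at distance at least 1/(n+1) from the complement *)
pose F n := [set x | forall y, ~ U y -> n.+1%:R^-1 <= mdist x y].
have cF n : closed (F n).
  rewrite -[F n]setCK; apply: open_closedC; rewrite openE => x.
  move=> /existsNP[y /not_implyP[Uy /negP]]; rewrite -ltNge => xy.
  have dl : 0 < n.+1%:R^-1 - mdist x y by rewrite subr_gt0.
  rewrite /interior; apply: filterS (nbhsx_ballx x _ dl) => z.
  rewrite in_ballE => xz /(_ y Uy); apply/negP; rewrite -ltNge.
  have := metric_triangle z x y; rewrite (metric_sym z x).
  by move: xz; move: (n.+1%:R^-1) => q; lra.
have FU n : F n `<=` U.
  move=> x Fx; apply: contrapT => /Fx; rewrite mdistxx; apply/negP.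
  by rewrite -ltNge invr_gt0.
have [|||n kn] := @small_tail (fun n => U `\` F n) e _ _ _ e0.
- move=> n; apply: measurableD; first exact: open_measurable_borel.
  rewrite -[F n]setCK; apply: measurableC; apply: open_measurable_borel.
  exact: closed_openC.
- move=> m n mn x [Ux nF]; split => // Fm; apply: nF => y Uy.
  apply: le_trans (Fm y Uy); rewrite lef_pV2 ?posrE//.
  by rewrite ler_nat ltnS.
- rewrite -subset0 => x /= h; have Ux := (h 0%N I).1.
  move: oU; rewrite openE => /(_ _ Ux); rewrite /interior -nbhs_ballE => -[r /= r0 rU].
  pose n := Num.bound r^-1; apply: (h n I).2 => y Uy.
  have nr : n.+1%:R^-1 <= r.
    rewrite -[leRHS]invrK lef_pV2 ?posrE ?invr_gt0//.
    have /ltW/le_trans : r^-1 < n%:R by apply: archi_boundP; rewrite invr_ge0 ltW.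
    by apply; rewrite ler_nat.
  rewrite (le_trans nr)// leNgt; apply/negP => xy; apply: Uy; apply: rU.
  by rewrite in_ballE.
by exists (F n), U; split.
Qed.

Let good_setC E : good E -> good (~` E).
Proof.
move=> gE e e0; have [F [U [cF oU FE EU k]]] := gE e e0.
exists (~` U), (~` F); split.
- exact: open_closedC.
- exact: closed_openC.
- exact: subsetC.
- exact: subsetC.
- by move: k; rewrite !setDE setCK setIC.
Qed.

Let good_bigcup (E : (set X)^nat) :
  (forall n, good (E n)) -> good (\bigcup_n E n).
Proof.
move=> gE e e0.
have e20 : 0 < e / 2 by lra.
have en n : 0 < e / 2 / (2 ^ n.+1)%:R by rewrite divr_gt0// ltr0n expn_gt0.
have /choice[FU hFU] : forall n, exists FU : set X * set X,
    [/\ closed FU.1, open FU.2, FU.1 `<=` E n, E n `<=` FU.2 &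
      (kappa (FU.2 `\` FU.1) <= (e / 2 / (2 ^ n.+1)%:R)%:E)%E].
  by move=> n; have [F [U h]] := gE n _ (en n); exists (F, U).
pose F n := (FU n).1; pose U n := (FU n).2.
have mU n : measurable (U n) by apply: open_measurable_borel; have [] := hFU n.
have mF n : measurable (F n).
  rewrite -[F n]setCK; apply: measurableC; apply: open_measurable_borel.
  by apply: closed_openC; have [] := hFU n.
pose Fn n := \bigcup_(i < n) F i.
have mFn n : measurable (Fn n) by apply: bigcup_measurable.
have mFF : measurable (\bigcup_n F n) by exact: bigcup_measurable.
have mUU : measurable (\bigcup_n U n) by exact: bigcup_measurable.
have [|||n kn] := @small_tail (fun n => \bigcup_n F n `\` Fn n) (e / 2) _ _ _ e20.
- by move=> n; exact: measurableD.
- move=> m n mn x [Fx nF]; split => // -[i /= im Fi]; apply: nF; exists i => //=.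
  exact: leq_trans mn.
- rewrite -subset0 => x /= h; have [[i _ Fi] _] := h 0%N I.
  by have [_] := h i.+1 I; apply; exists i => /=.
exists (Fn n), (\bigcup_n U n); split.
- rewrite /Fn bigcup_mkord; apply: closed_bigsetU => i _.
  by have [] := hFU i.
- by apply: bigcup_open => i _; have [] := hFU i.
- by move=> x [i _ Fi]; exists i => //; have [_ _ + _ _] := hFU i; apply.
- by move=> x [i _ Fi]; exists i => //; have [_ _ _ + _] := hFU i; apply.
have -> : e%:E = ((e / 2)%:E + (e / 2)%:E)%E by rewrite -EFinD; congr EFin; lra.
apply: (@le_trans _ _
    (kappa (\bigcup_n (U n `\` F n)) + kappa (\bigcup_n F n `\` Fn n))%E).
  apply: (@le_trans _ _ (kappa (\bigcup_n (U n `\` F n) `|` (\bigcup_n F n `\` Fn n)))).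
    apply: le_measure; rewrite ?inE.
    - exact: measurableD.
    - apply: measurableU; last exact: measurableD.
      by apply: bigcup_measurable => i _; exact: measurableD.
    move=> x [[i _ Ui] nF].
    have [Fx|Fx] := pselect ((\bigcup_n F n) x); first by right.
    by left; exists i => //; split => // Fi; apply: Fx; exists i.
  apply: measureU2; last exact: measurableD.
  by apply: bigcup_measurable => i _; exact: measurableD.
apply: leeD => //.
apply: (@le_trans _ _ (\sum_(i <oo) kappa (U i `\` F i))%E).
  have mD i : measurable (U i `\` F i) by exact: measurableD.
  by apply: measure_sigma_subadditive => //; exact: bigcup_measurable.
apply: le_trans (epsilon_trick0 xpredT (ltW e20)).
apply: lee_nneseries => // i _.
by have [] := hFU i.
Qed.

(** Closed sets are decreasing limits of open sets in a metric space, and the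
    sets squeezed between a closed and an open set of almost the same measure
    form a sigma-algebra. *)
Lemma outer_regular (E : set X) (e : R) : measurable E -> 0 < e ->
  exists2 U, open U /\ E `<=` U & (kappa U <= kappa E + e%:E)%E.
Proof.
move=> mE e0.
have gE : good E.
  have : (measurable : set (set X)) `<=` good.
    rewrite borel_measurableE; apply: smallest_sub; last exact: good_open.
    split.
    - by apply: good_open; exact: open0.
    - by move=> A gA; rewrite setTD; exact: good_setC.
    - exact: good_bigcup.
  exact.
have [F [U [cF oU FE EU k]]] := gE e e0.
exists U => //; have mU := open_measurable_borel oU.
apply: (@le_trans _ _ (kappa E + kappa (U `\` F))%E); last by rewrite leeD2l.
have mF : measurable F.
  rewrite -[F]setCK; apply: measurableC; apply: open_measurable_borel.
  exact: closed_openC.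
apply: (@le_trans _ _ (kappa (E `|` (U `\` F)))).
  apply: le_measure; rewrite ?inE//.
    by apply: measurableU => //; exact: measurableD.
  move=> x Ux; have [Fx|nF] := pselect (F x); first by left; exact: FE.
  by right.
by apply: measureU2 => //; exact: measurableD.
Qed.

End outer_regularity.


(** * Weights of class A_1 *)

(** The hypotheses on g are arguments so that the structure of measure can be
    attached to the function. *)
Definition density {R : realType} {d : measure_display} {X : borelMetricType R d}
    (mu : {measure set X -> \bar R}) (g : X -> R)
    (mg : measurable_fun setT g) (g0 : forall x, 0 <= g x) : set X -> \bar R :=
  wmeas mu g.

Section density_measure.
Context {R : realType} {d : measure_display} {X : borelMetricType R d}.
Variable mu : {measure set X -> \bar R}.
Variables (g : X -> R) (mg : measurable_fun setT g) (g0 : forall x, 0 <= g x).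

Let density0 : density mu mg g0 set0 = 0%E.
Proof. exact: integral_set0. Qed.

Let density_ge0 A : (0 <= density mu mg g0 A)%E.
Proof. by apply: integral_ge0 => x _; rewrite lee_fin. Qed.

Let density_sigma_additive : semi_sigma_additive (density mu mg g0).
Proof.
move=> F mF tF mUF; rewrite /density /wmeas ge0_integral_bigcup//.
- apply: is_cvg_nneseries => n _ _.
  by apply: integral_ge0 => x _; rewrite lee_fin.
- by apply/measurable_EFinP; exact: measurable_funTS.
- by move=> x _; rewrite lee_fin.
Qed.

HB.instance Definition _ := isMeasure.Build _ _ _ (density mu mg g0)
  density0 density_ge0 density_sigma_additive.

Lemma le_wmeas (A B : set X) : measurable A -> measurable B -> A `<=` B ->
  (wmeas mu g A <= wmeas mu g B)%E.
Proof.
move=> mA mB AB; apply: (@le_measure _ _ _ (density mu mg g0)); by rewrite ?inE.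
Qed.

Lemma wmeas_ge0 A : (0 <= wmeas mu g A)%E.
Proof using g0. by apply: integral_ge0 => x _; rewrite lee_fin. Qed.

End density_measure.

Definition wvol {R : realType} {d : measure_display} {X : borelMetricType R d}
    (mu : {measure set X -> \bar R}) (w : X -> R) (x : X) (r : R) : R :=
  fine (wmeas mu w (ball x r)).

Section A1_weights.
Context {R : realType} {d : measure_display} {X : borelMetricType R d}.
Variables (mu : {measure set X -> \bar R}) (mu_dbl : doubling mu).
Variables (w : X -> R) (wA1 : A1 mu w).
Implicit Types (x y z : X) (r s : R).

Lemma weight_ge0 x : 0 <= w x.
Proof. by case: wA1 => -[]. Qed.

Lemma measurable_weight : measurable_fun setT w.
Proof. by case: wA1 => -[_ [[]]]. Qed.

Lemma wvolE x r : 0 < r -> wmeas mu w (ball x r) = (wvol mu w x r)%:E.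
Proof.
move=> r0; rewrite /wvol fineK// ge0_fin_numE; last exact: (wmeas_ge0 mu weight_ge0).
case: wA1 => -[w0 [_ /(_ x r r0)/integrableP[_ h]] _] _; apply: le_lt_trans h.
rewrite le_eqVlt; apply/orP; left; apply/eqP; apply: eq_integral => y _ /=.
by rewrite expr0n /= addr0 sqrtr_sqr normr_id ger0_norm.
Qed.

Lemma wvol_ge0 x r : 0 <= wvol mu w x r.
Proof. exact/fine_ge0/(wmeas_ge0 mu weight_ge0). Qed.

Lemma le_wvol x y r s : 0 < r -> 0 < s -> mdist y x + r <= s ->
  wvol mu w x r <= wvol mu w y s.
Proof.
move=> r0 s0 h; rewrite -lee_fin -!wvolE//.
apply: (le_wmeas _ measurable_weight weight_ge0);
  [exact: ball_measurable..|exact: sub_ball].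
Qed.

Lemma A1_inhabited : exists x : X, True.
Proof.
apply: contrapT => noX; case: wA1 => -[_ _ wn0] _; apply: wn0.
by apply: aeW => x; exfalso; apply: noX; exists x.
Qed.

Let A1_const : exists2 C : R, 0 < C & forall x r, 0 < r ->
  {ae mu, forall y, ball x r y -> wvol mu w x r / vol mu x r <= C * w y}.
Proof.
case: wA1 => _ [C hC]; exists (Num.max 1 C); first by rewrite lt_max ltr01.
move=> x r r0; apply: filterS (hC x r r0) => y /[apply].
rewrite wvolE// -EFinM lee_fin mulrC => /le_trans; apply.
by rewrite ler_wpM2r ?weight_ge0// le_max lexx orbT.
Qed.

Lemma wmeas_eq0_ae (g : X -> R) (E : set X) : measurable_fun setT g ->
  (forall x, 0 <= g x) -> measurable E -> wmeas mu g E = 0%E ->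
  {ae mu, forall x, E x -> g x = 0}.
Proof.
move=> mg g0 mE gE0.
have mg' : measurable_fun E (EFin \o g).
  by apply/measurable_EFinP; exact: measurable_funTS.
have [+ _] := ae_eq_integral_abs mu mE mg'.
have -> : (\int[mu]_(x in E) `|(EFin \o g) x| = 0)%E.
  rewrite -gE0; apply: eq_integral => x _ /=.
  by rewrite ger0_norm.
by move=> /(_ erefl); apply: filterS => x /= h /h [].
Qed.

(** A_1 bounds w from below by its average, which is positive on all large
    balls because w does not vanish almost everywhere. *)
Lemma weight_gt0 : {ae mu, forall x, 0 < w x}.
Proof.
have [C C0 hC] := A1_const.
have [x0 _] := A1_inhabited.
have exhaust x : exists n, forall k, (n <= k)%N -> ball x0 k.+1%:R x.
  exists (Num.bound (mdist x0 x)) => k nk; rewrite in_ballE.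
  have /lt_le_trans : mdist x0 x < (Num.bound (mdist x0 x))%:R.
    by apply: archi_boundP; exact: mdist_ge0.
  by apply; rewrite ler_nat leqW.
have [n0 n0P] : exists n0, (0 < wmeas mu w (ball x0 n0.+1%:R))%E.
  apply: contrapT => h; case: wA1 => -[_ _ wn0] _; apply: wn0.
  have : forall n, {ae mu, forall x, ball x0 n.+1%:R x -> w x = 0}.
    move=> n; apply: (wmeas_eq0_ae measurable_weight weight_ge0).
      exact: ball_measurable.
    apply/eqP; rewrite eq_le (wmeas_ge0 mu weight_ge0) andbT leNgt.
    by apply/negP => hn; apply: h; exists n.
  move/ae_foralln; apply: filterS => x h0.
  by have [n /(_ n (leqnn n))] := exhaust x; exact: h0.
have : forall n, {ae mu, forall x, ball x0 n.+1%:R x -> (n0 <= n)%N -> 0 < w x}.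
  move=> n; have n1 : 0 < n.+1%:R :> R by [].
  apply: filterS (hC x0 n.+1%:R n1) => y /[apply] h n0n.
  rewrite lt_neqAle weight_ge0 andbT eq_sym; apply/eqP => wy0.
  move: h; rewrite wy0 mulr0 leNgt => /negP; apply.
  rewrite divr_gt0 ?vol_gt0// -lte_fin -wvolE//.
  apply: lt_le_trans n0P _.
  apply: (le_wmeas _ measurable_weight weight_ge0);
    [exact: ball_measurable..|apply: sub_ball].
  by rewrite mdistxx add0r ler_nat.
move/ae_foralln; apply: filterS => x h0.
have [n hn] := exhaust x.
by apply: (h0 (maxn n n0)); [apply: hn; rewrite leq_maxl|rewrite leq_maxr].
Qed.

Lemma wmeas_gt0 (E : set X) : measurable E -> (0 < mu E)%E -> (0 < wmeas mu w E)%E.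
Proof.
move=> mE muE; rewrite lt_neqAle (wmeas_ge0 mu weight_ge0) andbT eq_sym.
apply/eqP => wE0; move: muE; rewrite lt_neqAle => /andP[/eqP + _]; apply; apply/esym.
apply/(negligibleP mu mE).
have h : {ae mu, forall x, ~ E x}.
  apply: filterS2 (wmeas_eq0_ae measurable_weight weight_ge0 mE wE0) weight_gt0.
  by move=> x h wx /h wx0; move: wx; rewrite wx0 ltxx.
by apply: negligibleS h => x Ex /=; exact.
Qed.

Lemma wvol_gt0 x r : 0 < r -> 0 < wvol mu w x r.
Proof.
move=> r0; rewrite -lte_fin -wvolE//; apply: wmeas_gt0; first exact: ball_measurable.
by rewrite volE// lte_fin vol_gt0.
Qed.

(** Doubling of w follows from A_1 by integrating the defining inequality of
    the big ball over the small one. *)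
Lemma wvol_doubling : exists2 D : R, 1 <= D & forall n x r, 0 < r ->
  wvol mu w x (2 ^+ n * r) <= D ^+ n.+1 * wvol mu w x r.
Proof.
have [C C0 hC] := A1_const; have [D D1 dbl] := vol_doubling mu_dbl.
exists (Num.max C 1 * D).
  by rewrite -[leLHS]mul1r ler_pM ?le_max ?lexx ?orbT.
move=> n x r r0.
have nr0 : 0 < 2 ^+ n * r by rewrite mulr_gt0// exprn_gt0.
pose c := wvol mu w x (2 ^+ n * r) / vol mu x (2 ^+ n * r).
have c0 : 0 <= c by rewrite divr_ge0 ?wvol_ge0// ltW// vol_gt0.
have rnr : r <= 2 ^+ n * r by rewrite ler_peMl ?(ltW r0)// exprn_ege1 ?ler1n.
have : (\int[mu]_(y in ball x r) (cst c%:E y) <= \int[mu]_(y in ball x r) (C * w y)%:E)%E.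
  apply: ae_ge0_le_integral; first exact: ball_measurable.
  - by move=> y _; rewrite lee_fin.
  - exact: measurable_cst.
  - by move=> y _; rewrite lee_fin mulr_ge0 ?weight_ge0// ltW.
  - apply/measurable_EFinP; apply: measurable_funTS.
    by apply: measurable_funM => //; exact: measurable_weight.
  - apply: filterS (hC x _ nr0) => y h xy; rewrite lee_fin; apply: h.
    by move: xy; apply: sub_ball; rewrite mdistxx add0r.
rewrite integral_cst; last exact: ball_measurable.
under [leRHS]eq_integral do rewrite EFinM.
rewrite ge0_integralZl_EFin//; last 4 first.
- exact: ball_measurable.
- by move=> y _; rewrite lee_fin weight_ge0.
- by apply/measurable_EFinP; apply: measurable_funTS; exact: measurable_weight.
- exact: ltW.
rewrite -/(wmeas mu w (ball x r)) wvolE// volE// -!EFinM lee_fin => h.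
have v0 := vol_gt0 mu_dbl x r0; have vn0 := vol_gt0 mu_dbl x nr0.
have -> : wvol mu w x (2 ^+ n * r) = c * vol mu x (2 ^+ n * r).
  by rewrite /c divfK// gt_eqF.
apply: (@le_trans _ _ (c * (D ^+ n * vol mu x r))).
  by rewrite ler_wpM2l// dbl.
rewrite mulrCA; apply: (@le_trans _ _ (D ^+ n * (C * wvol mu w x r))).
  by rewrite ler_wpM2l// exprn_ge0//; lra.
rewrite mulrA ler_wpM2r ?wvol_ge0// exprMn mulrC.
rewrite ler_pM ?exprn_ge0 ?(ltW C0)//; [lra| |].
- apply: (@le_trans _ _ (Num.max C 1)); first by rewrite le_max lexx.
  by rewrite ler_eXnr// le_max lexx orbT.
- by rewrite exprS ler_peMl// exprn_ge0//; lra.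
Qed.

(** A_1 for the ball of radius 2 r around z; by doubling, the averages of w
    over it and over the balls of radius r inside it are comparable. *)
Lemma A1_ratio : exists2 C : R, 0 < C & forall z r, 0 < r ->
  {ae mu, forall x, ball z r x -> wvol mu w x r / vol mu x r <= C * w x}.
Proof.
have [C C0 hC] := A1_const; have [D D1 dbl] := vol_doubling mu_dbl.
exists (C * D ^+ 2); first by rewrite mulr_gt0// exprn_gt0//; lra.
move=> z r r0; have r20 : 0 < 2 * r by lra.
apply: filterS (hC z _ r20) => x h zx.
have v0 := vol_gt0 mu_dbl x r0; have v20 := vol_gt0 mu_dbl z r20.
move: (zx); rewrite in_ballE => zx'.
apply: (@le_trans _ _ (wvol mu w z (2 * r) / vol mu z (2 * r) * D ^+ 2)).
  rewrite ler_pdivrMr// -mulrA.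
  apply: (@le_trans _ _ (wvol mu w z (2 * r))); first by apply: le_wvol => //; lra.
  rewrite -mulrA; apply: ler_peMr; first exact: wvol_ge0.
  rewrite -mulrA [leRHS]mulrC ler_pdivlMr// mul1r.
  apply: le_trans (dbl 2 x r r0); apply: le_vol => //.
    by rewrite mulr_gt0// exprn_gt0.
  by rewrite metric_sym expr2; lra.
rewrite [leRHS]mulrAC; apply: ler_wpM2r; first by rewrite exprn_ge0//; lra.
by apply: h; move: zx; apply: sub_ball; rewrite mdistxx; lra.
Qed.

End A1_weights.

(** * Integration against a nonnegative density *)

Section wmeas_calculus.
Context {R : realType} {d : measure_display} {X : borelMetricType R d}.
Variable mu : {measure set X -> \bar R}.
Implicit Types (g : X -> R) (E : set X).

Lemma le_wmeas_fun g1 g2 E : measurable_fun setT g1 -> measurable_fun setT g2 ->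
  (forall x, 0 <= g1 x) -> (forall x, 0 <= g2 x) -> measurable E ->
  {ae mu, forall x, E x -> g1 x <= g2 x} -> (wmeas mu g1 E <= wmeas mu g2 E)%E.
Proof.
move=> m1 m2 g10 g20 mE h; apply: ae_ge0_le_integral => //.
- by move=> x _; rewrite lee_fin.
- by apply/measurable_EFinP; exact: measurable_funTS.
- by move=> x _; rewrite lee_fin.
- by apply/measurable_EFinP; exact: measurable_funTS.
Qed.

Lemma wmeasZ g E c : measurable_fun setT g -> (forall x, 0 <= g x) ->
  measurable E -> 0 <= c -> wmeas mu (fun x => c * g x) E = (c%:E * wmeas mu g E)%E.
Proof.
move=> mg g0 mE c0; rewrite /wmeas; under eq_integral do rewrite EFinM.
rewrite ge0_integralZl_EFin// => [x _|]; first by rewrite lee_fin.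
by apply/measurable_EFinP; exact: measurable_funTS.
Qed.

Lemma wmeasD g1 g2 E : measurable_fun setT g1 -> measurable_fun setT g2 ->
  (forall x, 0 <= g1 x) -> (forall x, 0 <= g2 x) -> measurable E ->
  wmeas mu (fun x => g1 x + g2 x) E = (wmeas mu g1 E + wmeas mu g2 E)%E.
Proof.
move=> m1 m2 g10 g20 mE; rewrite /wmeas; under eq_integral do rewrite EFinD.
rewrite ge0_integralD// => [x _||x _|]; rewrite ?lee_fin//.
- by apply/measurable_EFinP; exact: measurable_funTS.
- by apply/measurable_EFinP; exact: measurable_funTS.
Qed.

(** Domination by a countable combination of indicator functions: it turns a
    pointwise bound by layers into a bound of the integral. *)
Lemma wmeas_layers g (h : X -> R) (c : nat -> R) (A : (set X)^nat) E :
  measurable_fun setT h -> measurable_fun setT g -> (forall x, 0 <= h x) ->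
  (forall x, 0 <= g x) -> (forall n, 0 <= c n) -> (forall n, measurable (A n)) ->
  measurable E ->
  {ae mu, forall x, E x -> h x <= 0 \/ exists2 n, A n x & h x <= c n * g x} ->
  (wmeas mu h E <= \sum_(n <oo) ((c n)%:E * wmeas mu g (A n)))%E.
Proof.
move=> mh mg h0 g0 c0 mA mE hh.
pose f n x := ((c n)%:E * ((EFin \o g) \_ (A n)) x)%E.
have mr n : measurable_fun setT ((EFin \o g) \_ (A n)).
  apply/(measurable_restrictT _ (mA n)).1; apply/measurable_EFinP.
  exact: measurable_funTS.
have r0 n x : (0 <= ((EFin \o g) \_ (A n)) x)%E.
  by apply: erestrict_ge0 => y _; rewrite lee_fin.
have mf n : measurable_fun setT (f n).
  by apply: emeasurable_funM => //; exact: measurable_cst.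
have f0 n x : (0 <= f n x)%E by rewrite mule_ge0// lee_fin.
have -> : (\sum_(n <oo) ((c n)%:E * wmeas mu g (A n)) = \int[mu]_x \sum_(n <oo) f n x)%E.
  rewrite integral_nneseries//; apply: eq_eseriesr => n _.
  by rewrite ge0_integralZl_EFin// -integral_mkcond.
have ms : measurable_fun setT (fun x => \sum_(n <oo) f n x)%E.
  exact: ge0_emeasurable_sum.
have s0 x : (0 <= \sum_(n <oo) f n x)%E by exact: nneseries_ge0.
apply: (@le_trans _ _ (\int[mu]_(x in E) \sum_(n <oo) f n x)%E); last first.
  exact: ge0_subset_integral.
apply: ae_ge0_le_integral => //.
- by move=> x _; rewrite lee_fin.
- by apply/measurable_EFinP; exact: measurable_funTS.
- exact: measurable_funTS.
apply: filterS hh => x /[apply] -[hx|[n Anx hx]].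
  by apply: le_trans (s0 x); rewrite lee_fin.
apply: (@le_trans _ _ (f n x)).
  by rewrite /f patchE mem_set//= -EFinM lee_fin.
apply: le_trans (nneseries_lim_ge n.+1 _) => //.
by rewrite big_nat_recr//= leeDr// sume_ge0.
Qed.

Lemma sum_geometric (c : R) : 0 <= c ->
  (\sum_(n <oo) (c / 2 ^+ n)%:E <= (2 * c)%:E)%E.
Proof.
move=> c0; have c20 : 0 <= 2 * c by lra.
apply: le_trans (epsilon_trick0 xpredT c20).
apply: lee_nneseries => [n _|n _]; first by rewrite lee_fin divr_ge0// exprn_ge0.
rewrite lee_fin natrX exprS invfM mulrACA.
by rewrite divff// mul1r.
Qed.

End wmeas_calculus.

(** * Kernel estimates *)

Section complex_modulus.
Context {R : realType}.
Implicit Types z : R[i].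

Lemma normc_ge0 z : 0 <= cabs z.
Proof. by case: z => x y /=; exact: sqrtr_ge0. Qed.

Lemma normr_Re_le z : `|complex.Re z| <= cabs z.
Proof.
by case: z => x y /=; rewrite -sqrtr_sqr ler_wsqrtr// lerDl sqr_ge0.
Qed.

Lemma normr_Im_le z : `|complex.Im z| <= cabs z.
Proof.
by case: z => x y /=; rewrite -sqrtr_sqr ler_wsqrtr// lerDr sqr_ge0.
Qed.

Lemma normc_le_ReIm z : cabs z <= `|complex.Re z| + `|complex.Im z|.
Proof.
case: z => x y /=; rewrite -[leRHS]ger0_norm ?addr_ge0// -sqrtr_sqr.
rewrite ler_wsqrtr// sqrrD !real_normK ?num_real//.
by rewrite -addrA lerD2l lerDr mulrn_wge0// mulr_ge0.
Qed.

Context {d : measure_display} {T : measurableType d}.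
Implicit Types f g : T -> R[i].

Lemma measurable_normc f : cmeasurable f -> measurable_fun setT (fun x => cabs (f x)).
Proof.
move=> [mr mi].
have -> : (fun x => cabs (f x)) =
    (Num.sqrt \o (fun x => complex.Re (f x) ^+ 2 + complex.Im (f x) ^+ 2)).
  by apply/funext => x /=; case: (f x).
apply: measurableT_comp.
  by apply: continuous_measurable_fun; exact: sqrt_continuous.
by apply: measurable_funD; apply: measurable_funX.
Qed.

Lemma cmeasurableM f g : cmeasurable f -> cmeasurable g ->
  cmeasurable (fun x => f x * g x).
Proof.
move=> [fr fi] [gr gi]; split.
- have -> : (fun x => complex.Re (f x * g x)) = (fun x =>
    complex.Re (f x) * complex.Re (g x) - complex.Im (f x) * complex.Im (g x)).
    by apply/funext => x; case: (f x) (g x) => ? ? [].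
  by apply: measurable_funB; apply: measurable_funM.
- have -> : (fun x => complex.Im (f x * g x)) = (fun x =>
    complex.Re (f x) * complex.Im (g x) + complex.Im (f x) * complex.Re (g x)).
    by apply/funext => x; case: (f x) (g x) => ? ? [].
  by apply: measurable_funD; apply: measurable_funM.
Qed.

Lemma cmeasurableB f g : cmeasurable f -> cmeasurable g ->
  cmeasurable (fun x => f x - g x).
Proof.
move=> [fr fi] [gr gi]; split.
- have -> : (fun x => complex.Re (f x - g x)) = (fun x =>
    complex.Re (f x) - complex.Re (g x)).
    by apply/funext => x; case: (f x) (g x) => ? ? [].
  exact: measurable_funB.
- have -> : (fun x => complex.Im (f x - g x)) = (fun x =>
    complex.Im (f x) - complex.Im (g x)).
    by apply/funext => x; case: (f x) (g x) => ? ? [].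
  exact: measurable_funB.
Qed.

End complex_modulus.

Section kernel.
Context {R : realType} {d : measure_display} {X : borelMetricType R d}.
Variables (mu : {measure set X -> \bar R}) (mu_dbl : doubling mu).
Variables (m : R) (m_ge2 : 2 <= m) (a : R -> X -> X -> R[i]).
Hypotheses (a_meas : jointly_measurable a) (a_bound : gaussian_bound mu a m).
Implicit Types (x y z : X) (r s : R).

(** Only the polynomial decay of the Gaussian factor matters. *)
Lemma expR_powR_decay (c p : R) (M : nat) : 0 < c -> 1 <= p ->
  exists2 K, 0 < K & forall u, 0 <= u ->
    expR (- (c * u `^ p)) <= K / (1 + u) ^+ M.
Proof.
move=> c0 p1.
pose K := expR (c * 2) * ((M.+1)`!%:R / c ^+ M.+1).
have K0 : 0 < K.
  by rewrite mulr_gt0 ?expR_gt0// divr_gt0 ?exprn_gt0// ltr0n fact_gt0.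
exists K => // u u0.
have v0 : 0 < 1 + u by lra.
(* the additive c covers u <= 1, where u `^ p may be smaller than u *)
have e1 : c * u <= c + c * u `^ p.
  have [u1|u1] := leP u 1.
    by have := powR_ge0 u p; nra.
  have : u <= u `^ p.
    by rewrite -[leLHS]powRr1//; apply: ler_powR => //; exact: ltW.
  by nra.
apply: (@le_trans _ _ (expR (c * 2) * expR (- (c * (1 + u))))).
  by rewrite -expRD ler_expR; lra.
rewrite /K -mulrA ler_pM2l ?expR_gt0// expRN.
have cv0 : 0 < c * (1 + u) by exact: mulr_gt0.
pose q := (c * (1 + u)) ^+ M.+1 / (M.+1)`!%:R.
have h : 1 + q <= expR (c * (1 + u)) := expR_ge1Dxn M (ltW cv0).
have q0 : 0 < q by rewrite divr_gt0 ?exprn_gt0// ltr0n fact_gt0.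
apply: (@le_trans _ _ q^-1).
  rewrite lef_pV2 ?posrE ?expR_gt0//; apply: le_trans h.
  by rewrite lerDr.
rewrite /q exprMn invf_div invfM mulrA ler_wpM2l//.
  by rewrite divr_ge0 ?ler0n// exprn_ge0// ltW.
rewrite lef_pV2 ?posrE ?exprn_gt0//; apply: ler_weXn2l; [lra|exact: leqnSn].
Qed.

Lemma powR_conv_r r : 0 < r -> (r `^ m) `^ m^-1 = r.
Proof.
move=> r0; have m0 : m != 0 by rewrite gt_eqF// (lt_le_trans _ m_ge2).
by rewrite -powRrM divff// powRr1// ltW.
Qed.

Lemma cmeasurable_kernel t x : 0 < t -> cmeasurable (a t x).
Proof.
move=> t0; have [mr mi] := a_meas t0; split.
- exact: (measurableT_comp mr (pair1_measurable x)).
- exact: (measurableT_comp mi (pair1_measurable x)).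
Qed.

Lemma kernel_decay (M : nat) : exists2 K, 0 < K & forall r x y, 0 < r ->
  cabs (a (r `^ m) x y) <= K / vol mu x r / (1 + mdist x y / r) ^+ M.
Proof.
case: a_bound => C [c [C0 c0 h]].
have m2 : 2 <= m by exact: m_ge2.
have m1 : 0 < m - 1 by lra.
have p1 : 1 <= m / (m - 1) by rewrite ler_pdivlMr//; lra.
have [K K0 hK] := expR_powR_decay M c0 p1.
exists (C * K) => [|r x y r0]; first exact: mulr_gt0.
have rm0 : 0 < r `^ m by exact: powR_gt0.
apply: le_trans (h _ x y rm0) _; rewrite powR_conv_r//.
have v0 := vol_gt0 mu_dbl x r0.
have dr : 0 <= mdist x y / r by rewrite divr_ge0 ?mdist_ge0// ltW.
have -> : mdist x y `^ (m / (m - 1)) / (r `^ m) `^ (m - 1)^-1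
    = (mdist x y / r) `^ (m / (m - 1)).
  rewrite -powRrM -[X in X `^ _ / _](divfK (lt0r_neq0 r0)).
  by rewrite powRM ?(ltW r0)// mulfK// powR_eq0 negb_and (gt_eqF r0).
have -> : C * K / vol mu x r / (1 + mdist x y / r) ^+ M =
    C / vol mu x r * (K / (1 + mdist x y / r) ^+ M) by ring.
by apply: ler_wpM2l; [rewrite divr_ge0// ltW|exact: hK].
Qed.

(** If the integrals of F over the balls of radius 2^j r around x grow at most
    like 2^(j q), the kernel at scale r averages F as if it were supported in
    the ball of radius r. *)
Lemma kernel_integral_le (q : nat) : exists2 K, 0 < K &
  forall r x (F : X -> R) L, 0 < r -> 0 <= L ->
    measurable_fun setT F -> (forall y, 0 <= F y) ->
    (forall j, (wmeas mu F (ball x (2 ^+ j * r)) <= (L * (2 ^+ q) ^+ j)%:E)%E) ->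
    (wmeas mu (fun y => cabs (a (r `^ m) x y) * F y)%R setT
       <= (K * L / vol mu x r)%:E)%E.
Proof.
have [K K0 hK] := kernel_decay q.+1.
exists (2 * (2 ^+ q.+1 * K)) => [|r x F L r0 L0 mF F0 hF].
  by rewrite !mulr_gt0// exprn_gt0.
have v0 := vol_gt0 mu_dbl x r0.
have rm0 : 0 < r `^ m by exact: powR_gt0.
pose c j := 2 ^+ q.+1 * K / vol mu x r / (2 ^+ q.+1) ^+ j.
have c0 j : 0 <= c j.
  by rewrite !divr_ge0 ?mulr_ge0 ?exprn_ge0 ?(ltW K0) ?(ltW v0)// exprn_ge0.
have mh : measurable_fun setT (fun y => cabs (a (r `^ m) x y) * F y).
  apply: measurable_funM => //.
  by apply: measurable_normc; exact: cmeasurable_kernel.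
apply: le_trans (@wmeas_layers _ _ _ mu F _ c (fun j => ball x (2 ^+ j * r))
  _ _ _ _ _ _ _ _ _) _ => //.
- by move=> y; rewrite mulr_ge0 ?normc_ge0.
- by move=> j; exact: ball_measurable.
- apply: aeW => y _; right.
  have dr : 0 <= mdist x y / r by rewrite divr_ge0 ?mdist_ge0// ltW.
  have ex : exists j, mdist x y / r < 2 ^+ j.
    by exists (Num.bound (mdist x y / r)); apply: upper_nthrootP.
  case: (ex_minnP ex) => j dj jmin; exists j.
    by rewrite in_ballE -ltr_pdivrMr.
  apply: ler_wpM2r => //; apply: le_trans (hK _ _ _ r0) _.
  rewrite /c; have kv : 0 <= K / vol mu x r by rewrite divr_ge0 ?ltW.
  have -> : 2 ^+ q.+1 * K / vol mu x r / (2 ^+ q.+1) ^+ j =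
      K / vol mu x r * (2 ^+ q.+1 / (2 ^+ q.+1) ^+ j) by ring.
  apply: ler_wpM2l => //.
  have p0 : 0 < (1 + mdist x y / r) ^+ q.+1 by rewrite exprn_gt0//; lra.
  rewrite -[leLHS]mul1r ler_pdivrMr// mulrAC ler_pdivlMr ?exprn_gt0// mul1r.
  rewrite exprAC -exprMn; apply: lerXn2r; rewrite ?nnegrE ?exprn_ge0//.
    by rewrite mulr_ge0//; lra.
  case: j jmin {dj ex} => [_|j jmin]; first by rewrite expr0; lra.
  have : 2 ^+ j <= mdist x y / r.
    by rewrite leNgt; apply/negP => /jmin; rewrite ltnn.
  by rewrite exprS; lra.
apply: (@le_trans _ _ (\sum_(n <oo) ((2 ^+ q.+1 * K / vol mu x r * L) / 2 ^+ n)%:E)%E).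
  apply: lee_nneseries => [j _|j _].
    by rewrite mule_ge0 ?lee_fin//; exact: wmeas_ge0.
  apply: (@le_trans _ _ ((c j)%:E * (L * (2 ^+ q) ^+ j)%:E)%E).
    by apply: lee_wpmul2l; rewrite ?lee_fin.
  rewrite -EFinM lee_fin /c le_eqVlt; apply/orP; left; apply/eqP.
  rewrite (exprS 2 q) [in X in _ / X * _]exprMn.
  have n1 : 2 ^+ j != 0 :> R by rewrite expf_neq0.
  have n2 : (2 ^+ q) ^+ j != 0 :> R by rewrite !expf_neq0.
  by field; rewrite n1 n2 gt_eqF.
apply: le_trans (sum_geometric _) _.
  by rewrite mulr_ge0// divr_ge0 ?(ltW v0)// mulr_ge0 ?exprn_ge0// ltW.
by rewrite lee_fin le_eqVlt; apply/orP; left; apply/eqP; ring.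
Qed.

End kernel.

(** * The operators on functions of the class M *)

Section operator_measurability.
Context {R : realType} {d : measure_display} {X : borelMetricType R d}.
Variables (mu : {measure set X -> \bar R}) (mu_dbl : doubling mu).

Lemma doubling_sigma_finite : sigma_finite setT mu.
Proof.
have [[x0 _]|noX] := pselect (exists x0 : X, True); last first.
  exists (fun _ => set0); last by move=> i; split; rewrite ?measure0.
  by rewrite bigcup0// -subset0 => x _; apply: noX; exists x.
exists (fun n => ball x0 n.+1%:R) => [|n]; last first.
  by split; [exact: ball_measurable|rewrite volE// ltry].
apply/esym; rewrite -subTset => x _; exists (Num.bound (mdist x0 x)) => //.
rewrite in_ballE.
have /lt_le_trans : mdist x0 x < (Num.bound (mdist x0 x))%:R.
  by apply: archi_boundP; exact: mdist_ge0.
by apply; rewrite ler_nat.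
Qed.

(** Tonelli's theorem for the positive and the negative part separately, so that
    the sections of h may fail to be integrable. *)
Let measurable_Rintegral (h : X * X -> R) : measurable_fun setT h ->
  measurable_fun setT (fun x => \int[mu]_y h (x, y)).
Proof.
move=> mh.
pose S1 := isSFinite.Build _ _ _ (Measure.sort mu)
  (sfinite_measure_sigma_finite doubling_sigma_finite).
pose S2 := isSigmaFinite.Build _ _ _ (Measure.sort mu) doubling_sigma_finite.
pose mu' : {sigma_finite_measure set X -> \bar R} :=
  HB.pack_for (SigmaFiniteMeasure.type X R) (Measure.sort mu) S1 S2.
have mE : measurable_fun setT (EFin \o h) by exact/measurable_EFinP.
apply: (measurableT_comp (fine_measurable measurableT)).
have -> : (fun x => \int[mu]_y (h (x, y))%:E)%E = (fun x =>
    (\int[mu']_y (EFin \o h)^\+ (x, y)) - (\int[mu']_y (EFin \o h)^\- (x, y)))%E.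
  have muE (g : X -> \bar R) : (\int[mu]_y g y = \int[mu']_y g y)%E.
    exact: eq_measure_integral.
  apply/funext => x; rewrite integralE; congr (_ - _)%E; rewrite muE;
    by apply: eq_integral => y _; rewrite ?funeposE ?funenegE.
apply: emeasurable_funB.
- have := @measurable_fun_fubini_tonelli_F _ _ X X R mu' (funepos (EFin \o h)).
  by apply; [exact: measurable_funepos|exact: funepos_ge0].
- have := @measurable_fun_fubini_tonelli_F _ _ X X R mu' (funeneg (EFin \o h)).
  by apply; [exact: measurable_funeneg|exact: funeneg_ge0].
Qed.

Lemma cmeasurable_opA (a : R -> X -> X -> R[i]) (f : X -> R[i]) t :
  jointly_measurable a -> 0 < t -> cmeasurable f -> cmeasurable (opA mu a t f).
Proof.
move=> ma t0 [fr fi]; have [ar ai] := ma t t0.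
have fr2 : measurable_fun setT (fun z : X * X => complex.Re (f z.2)).
  exact: (measurableT_comp fr).
have fi2 : measurable_fun setT (fun z : X * X => complex.Im (f z.2)).
  exact: (measurableT_comp fi).
have [hr hi] : cmeasurable (fun z : X * X => a t z.1 z.2 * f z.2).
  exact: cmeasurableM.
split.
- exact: (measurable_Rintegral hr).
- exact: (measurable_Rintegral hi).
Qed.

End operator_measurability.

(** The integral of a nonnegative function is a supremum over the simple
    functions below it. In this form monotonicity applies to the weight of the
    class M, of which the measurability is then not at issue. *)
Lemma ge0_le_integral_nomeas {d : measure_display} {T : measurableType d}
    {R : realType} (mu : {measure set T -> \bar R}) (f1 f2 : T -> \bar R) :
  (forall x, (0 <= f1 x)%E) -> (forall x, (f1 x <= f2 x)%E) ->
  (\int[mu]_x f1 x <= \int[mu]_x f2 x)%E.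
Proof.
move=> f10 f12; rewrite !ge0_integralTE// => [|x]; last exact: le_trans (f12 x).
apply: le_ereal_sup => _ [h hf <-]; exists h => // x.
exact: le_trans (hf x) (f12 x).
Qed.

Section operator_estimates.
Context {R : realType} {d : measure_display} {X : borelMetricType R d}.
Variables (mu : {measure set X -> \bar R}) (mu_dbl : doubling mu).
Variables (a : R -> X -> X -> R[i]) (a_meas : jointly_measurable a).
Implicit Types (x y z : X) (r s t : R) (f g h : X -> R[i]).

Let measurable_absorb t x f : 0 < t -> cmeasurable f ->
  measurable_fun setT (fun y => cabs (a t x y) * cabs (f y)).
Proof.
move=> t0 mf; apply: measurable_funM; last exact: measurable_normc.
exact: (measurable_normc (cmeasurable_kernel a_meas x t0)).
Qed.

Let integrable_part (part : R[i] -> R) t x f : 0 < t -> cmeasurable f ->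
  (forall u, `|part u| <= cabs u) ->
  measurable_fun setT (fun y => part (a t x y * f y)) ->
  (wmeas mu (fun y => cabs (a t x y) * cabs (f y))%R setT < +oo)%E ->
  mu.-integrable setT (EFin \o (fun y => part (a t x y * f y))).
Proof.
move=> t0 mf hp mp fin; apply/integrableP; split; first exact/measurable_EFinP.
apply: le_lt_trans fin; apply: ge0_le_integral => //.
- by apply/measurable_EFinP; exact: measurableT_comp.
- by apply/measurable_EFinP; exact: measurable_absorb.
- by move=> y _; rewrite /= lee_fin -ComplexField.Normc.normcM.
Qed.

Lemma opAB t f h x : 0 < t -> cmeasurable f -> cmeasurable h ->
  (wmeas mu (fun y => cabs (a t x y) * cabs (f y))%R setT < +oo)%E ->
  (wmeas mu (fun y => cabs (a t x y) * cabs (h y))%R setT < +oo)%E ->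
  opA mu a t (fun y => f y - h y) x = opA mu a t f x - opA mu a t h x.
Proof.
move=> t0 mf mh ff fh.
have [mrf mif] := cmeasurableM (cmeasurable_kernel a_meas x t0) mf.
have [mrh mih] := cmeasurableM (cmeasurable_kernel a_meas x t0) mh.
have irf := integrable_part t0 mf (@normr_Re_le R) mrf ff.
have irh := integrable_part t0 mh (@normr_Re_le R) mrh fh.
have iif := integrable_part t0 mf (@normr_Im_le R) mif ff.
have iih := integrable_part t0 mh (@normr_Im_le R) mih fh.
rewrite /opA /cintegral; apply/eqP; rewrite eq_complex /=; apply/andP; split; apply/eqP.
- rewrite -RintegralB//; apply: eq_Rintegral => y _.
  by rewrite mulrBr raddfB.
- rewrite -RintegralB//; apply: eq_Rintegral => y _.
  by rewrite mulrBr raddfB.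
Qed.

Lemma normc_opA_le t f x B : 0 < t -> cmeasurable f ->
  (wmeas mu (fun y => cabs (a t x y) * cabs (f y))%R setT <= B%:E)%E ->
  cabs (opA mu a t f x) <= 2 * B.
Proof.
move=> t0 mf fB.
have ff := le_lt_trans fB (ltry B).
have [mrf mif] := cmeasurableM (cmeasurable_kernel a_meas x t0) mf.
have bound (part : R[i] -> R) : (forall u, `|part u| <= cabs u) ->
    measurable_fun setT (fun y => part (a t x y * f y)) ->
    `|\int[mu]_y part (a t x y * f y)| <= B.
  move=> hp mp; have ip := integrable_part t0 mf hp mp ff.
  rewrite -lee_fin EFin_normr_Rintegral//.
  apply: le_trans (le_abse_integral _ _ _) _ => //; first exact/measurable_EFinP.
  apply: le_trans fB; apply: ge0_le_integral => //.
  - by apply/measurable_EFinP; exact: measurableT_comp.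
  - by apply/measurable_EFinP; exact: measurable_absorb.
  - by move=> y _; rewrite /= lee_fin -ComplexField.Normc.normcM.
apply: le_trans (normc_le_ReIm _) _ => /=.
have := bound _ (@normr_Re_le R) mrf; have := bound _ (@normr_Im_le R) mif.
lra.
Qed.

(** The substitute for the semigroup property: since the two operators commute,
    A_t f - A_s f = A_t (f - A_s f) - A_s (f - A_t f). *)
Lemma opA_difference_le m f s r : commuting mu a -> 0 < s -> 0 < r ->
  classM mu f ->
  (forall x, wmeas mu (fun y => cabs (a (s `^ m) x y) * cabs (f y))%R setT < +oo)%E ->
  (forall x, wmeas mu (fun y => cabs (a (r `^ m) x y) * cabs (f y))%R setT < +oo)%E ->
  {ae mu, forall x, forall B1 B2 : R,
    (wmeas mu (fun y => cabs (a (s `^ m) x y) *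
       cabs (f y - opA mu a (r `^ m) f y))%R setT <= B1%:E)%E ->
    (wmeas mu (fun y => cabs (a (r `^ m) x y) *
       cabs (f y - opA mu a (s `^ m) f y))%R setT <= B2%:E)%E ->
    cabs (opA mu a (s `^ m) f x - opA mu a (r `^ m) f x) <= 2 * B1 + 2 * B2}.
Proof.
move=> acomm s0 r0 fM fs fr.
have mf : cmeasurable f by case: fM => x0 [b [_ [[]]]].
have sm0 : 0 < s `^ m by exact: powR_gt0.
have rm0 : 0 < r `^ m by exact: powR_gt0.
have mAs := cmeasurable_opA mu_dbl a_meas sm0 mf.
have mAr := cmeasurable_opA mu_dbl a_meas rm0 mf.
have subK (u v : R[i]) : u - (u - v) = v by rewrite opprB addrC subrK.
apply: filterS (acomm _ _ _ sm0 rm0 fM) => x comm B1 B2 h1 h2.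
have swap (p q u v : R[i]) : p - u = q - v -> p - q = u - v.
  by move=> puqv; rewrite -[p](subrK u) puqv addrAC [q - v - q]addrAC subrr add0r addrC.
have cancel_f g : (fun y => f y - (f y - g y)) = g.
  by apply/funext => y; exact: subK.
have e1 := opAB sm0 mf (cmeasurableB mf mAr) (fs x) (le_lt_trans h1 (ltry _)).
have e2 := opAB rm0 mf (cmeasurableB mf mAs) (fr x) (le_lt_trans h2 (ltry _)).
rewrite cancel_f in e1; rewrite cancel_f in e2.
have -> : opA mu a (s `^ m) f x - opA mu a (r `^ m) f x =
    opA mu a (s `^ m) (fun y => f y - opA mu a (r `^ m) f y) x
    - opA mu a (r `^ m) (fun y => f y - opA mu a (s `^ m) f y) x.
  exact: (swap _ _ _ _ (etrans (esym e1) (etrans comm e2))).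
apply: le_trans (le_normcD _ _) _; rewrite normcN; apply: lerD.
- exact: (normc_opA_le sm0 (cmeasurableB mf mAr) h1).
- exact: (normc_opA_le rm0 (cmeasurableB mf mAs) h2).
Qed.

End operator_estimates.

Section class_M.
Context {R : realType} {d : measure_display} {X : borelMetricType R d}.
Variables (mu : {measure set X -> \bar R}) (mu_dbl : doubling mu).

(** Functions of the class M have integrals of polynomial growth, because
    |f| <= |f|^2 / W + W for the weight W of their type. *)
Lemma classM_growth (f : X -> R[i]) x r : 0 < r -> classM mu f ->
  exists (q : nat) (L : R), 0 <= L /\ forall j,
    (wmeas mu (fun y => cabs (f y)) (ball x (2 ^+ j * r)%R)
       <= (L * (2 ^+ q) ^+ j)%:E)%E.
Proof.
move=> r0 [x0 [b [b0 [[mf _]]]]].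
set W := (fun y => (1 + mdist x0 y) `^ b * vol mu x0 (1 + mdist x0 y)).
move=> fW.
have W0 y : 0 < W y.
  by have ? := mdist_ge0 x0 y; rewrite mulr_gt0 ?powR_gt0 ?vol_gt0//; lra.
have I0 : (0 <= \int[mu]_y (cabs (f y) ^+ 2 / W y)%:E)%E.
  by apply: integral_ge0 => y _; rewrite lee_fin divr_ge0 ?sqr_ge0// ltW.
pose I := fine (\int[mu]_y (cabs (f y) ^+ 2 / W y)%:E).
have IE : (\int[mu]_y (cabs (f y) ^+ 2 / W y)%:E = I%:E)%E.
  by rewrite /I fineK// ge0_fin_numE.
have {}I0 : 0 <= I by rewrite -lee_fin -IE.
have [D D1 dbl] := vol_doubling mu_dbl.
have D0 : 0 <= D by lra.
pose e := Num.bound D; have De : D <= 2 ^+ e by apply/ltW/upper_nthrootP.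
pose n := Num.bound b; have bn : b <= n%:R by apply/ltW/archi_boundP/ltW.
pose sg := 1 + mdist x0 x + r.
have sg0 : 0 < sg by have ? := mdist_ge0 x0 x; rewrite /sg; lra.
exists (n + e + e)%N, (I + sg `^ b * vol mu x0 sg * vol mu x r).
have v0 := vol_gt0 mu_dbl x r0; have v1 := vol_gt0 mu_dbl x0 sg0.
have c0 : 0 <= sg `^ b * vol mu x0 sg * vol mu x r.
  by rewrite !mulr_ge0 ?powR_ge0// ltW.
split=> [|j]; first exact: addr_ge0.
have p2 k : 1 <= 2 ^+ k :> R by rewrite exprn_ege1// ler1n.
have p0 k : 0 < 2 ^+ k :> R by rewrite exprn_gt0.
pose S := (2 ^+ j * sg) `^ b * vol mu x0 (2 ^+ j * sg).
have jsg0 : 0 < 2 ^+ j * sg by rewrite mulr_gt0.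
have S0 : 0 < S by rewrite mulr_gt0 ?powR_gt0 ?vol_gt0.
have WS y : ball x (2 ^+ j * r) y -> W y <= S.
  rewrite in_ballE => xy; have ? := mdist_ge0 x0 y.
  have ySg : 1 + mdist x0 y <= 2 ^+ j * sg.
    have := metric_triangle x0 x y; have := p2 j; have := mdist_ge0 x0 x.
    by rewrite /sg; move: xy; set u := 2 ^+ j; nra.
  apply: ler_pM; rewrite ?powR_ge0 ?(ltW (vol_gt0 _ _ _))//; first by lra.
    by apply: ge0_ler_powR; rewrite ?nnegrE// ?ltW//; lra.
  by apply: le_vol => //; rewrite ?mdistxx ?add0r//; lra.
have mB := ball_measurable x (2 ^+ j * r).
have mc : measurable_fun setT (fun y => cabs (f y)) by exact: measurable_normc.
have m2 : measurable_fun setT (fun y => S^-1 * cabs (f y) ^+ 2).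
  by apply: measurable_funM => //; exact: measurable_funX.
have S1 : 0 <= S^-1 by rewrite invr_ge0 ltW.
have n2 y : 0 <= S^-1 * cabs (f y) ^+ 2 by rewrite mulr_ge0 ?sqr_ge0.
apply: (@le_trans _ _ (wmeas mu (fun y => S^-1 * cabs (f y) ^+ 2 + S)
    (ball x (2 ^+ j * r)%R))).
  apply: le_wmeas_fun => //.
  - exact: measurable_funD.
  - by move=> y; exact: normc_ge0.
  - by move=> y; rewrite addr_ge0// ltW.
  - apply: aeW => y _.
    have [h|h] := leP (cabs (f y)) S; first by rewrite ler_wpDl.
    rewrite ler_wpDr ?(ltW S0)// expr2 mulrA ler_peMl ?normc_ge0//.
    by rewrite mulrC ler_pdivlMr// mul1r ltW.
rewrite wmeasD//; last by move=> _; exact: ltW.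
have -> : wmeas mu (fun=> S) (ball x (2 ^+ j * r)) = (S * vol mu x (2 ^+ j * r))%:E.
  by rewrite /wmeas integral_cst// volE// mulr_gt0.
apply: (@le_trans _ _ (I%:E + (S * vol mu x (2 ^+ j * r))%:E)%E).
  apply: leeD => //; rewrite -IE /wmeas integral_mkcond.
  apply: ge0_le_integral_nomeas => y.
    by apply: erestrict_ge0 => z _; rewrite lee_fin.
  rewrite patchE; case: ifPn => [|_]; last by rewrite lee_fin divr_ge0 ?sqr_ge0// ltW.
  rewrite inE => /WS h; rewrite lee_fin mulrC ler_wpM2l ?sqr_ge0//.
  by rewrite lef_pV2 ?posrE.
rewrite -EFinD lee_fin mulrDl; apply: lerD.
  by rewrite ler_peMr// -exprM.
have h1 : (2 ^+ j * sg) `^ b <= (2 ^+ n) ^+ j * sg `^ b.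
  rewrite powRM ?(ltW sg0) ?(ltW (p0 _))//; apply: ler_wpM2r; first exact: powR_ge0.
  rewrite exprAC -(powR_mulrn n (ltW (p0 j))).
  exact: ler_powR.
have hD k : D ^+ k <= (2 ^+ e) ^+ k by apply: lerXn2r; rewrite ?nnegrE ?exprn_ge0.
have h2 : vol mu x0 (2 ^+ j * sg) <= (2 ^+ e) ^+ j * vol mu x0 sg.
  by apply: le_trans (dbl j x0 sg sg0) _; rewrite ler_wpM2r// ltW.
have h3 : vol mu x (2 ^+ j * r) <= (2 ^+ e) ^+ j * vol mu x r.
  by apply: le_trans (dbl j x r r0) _; rewrite ler_wpM2r// ltW.
have -> : sg `^ b * vol mu x0 sg * vol mu x r * (2 ^+ (n + e + e)) ^+ j =
    (2 ^+ n) ^+ j * sg `^ b * ((2 ^+ e) ^+ j * vol mu x0 sg) *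
    ((2 ^+ e) ^+ j * vol mu x r) by rewrite !exprD !exprMn; ring.
apply: ler_pM => //; rewrite ?(ltW S0)//.
  by apply/ltW/vol_gt0; rewrite ?mulr_gt0.
apply: ler_pM => //; first exact: powR_ge0.
by apply/ltW/vol_gt0.
Qed.

End class_M.

(** * From averages to pointwise bounds *)

Lemma measurable_lt_set {d : measure_display} {T : measurableType d} {R : realType}
  (f g : T -> R) : measurable_fun setT f -> measurable_fun setT g ->
  measurable [set x | f x < g x].
Proof.
move=> mf mg.
have := measurable_fun_ltr mf mg measurableT (Y := [set true]) I.
by rewrite setTI.
Qed.

Section controlled.
Context {R : realType} {d : measure_display} {X : borelMetricType R d}.
Variables (mu : {measure set X -> \bar R}) (mu_dbl : doubling mu).
Variables (w : X -> R) (wA1 : A1 mu w).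
Implicit Types (x y z : X) (r s N L : R) (F : X -> R).

Let w0 := weight_ge0 wA1.
Let mw := measurable_weight wA1.

(** A ball of radius r >= s is covered by balls of radius s whose halves are
    disjoint, and nu is doubling. *)
Lemma average_larger_scale : exists2 C, 1 <= C & forall F s N, 0 < s -> 0 <= N ->
  measurable_fun setT F -> (forall x, 0 <= F x) ->
  (forall x, (wmeas mu F (ball x s) <= (N * wvol mu w x s)%:E)%E) ->
  forall x r, s <= r -> (wmeas mu F (ball x r) <= (C * N * wvol mu w x r)%:E)%E.
Proof.
have [D D1 dbl] := wvol_doubling mu_dbl wA1.
have D0 : 0 <= D by lra.
exists (D ^+ 4); first exact: exprn_ege1.
move=> F s N s0 N0 mF F0 hF x r sr.
have r0 : 0 < r by lra.
have s20 : 0 < s / 2 by lra.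
have [t [ut tb tt tc]] := finite_net mu_dbl x s0 r0.
apply: (@le_trans _ _ (\sum_(y <- t) wmeas mu F (ball y s))%E).
  rewrite (fsbig_seq _ _ ut).
  apply: (@content_sub_fsum _ _ _ (density mu mF F0) _ [set` t] _ (fun y => ball y s)).
  - exact: finite_seq.
  - by move=> y _; exact: ball_measurable.
  - exact: ball_measurable.
  - by move=> z /tc[y yt yz]; exists y.
have -> : (D ^+ 4 * N * wvol mu w x r)%:E =
    ((N * D ^+ 2)%:E * (D ^+ 2 * wvol mu w x r)%:E)%E.
  by rewrite -EFinM; congr EFin; ring.
apply: (@le_trans _ _ (\sum_(y <- t) ((N * D ^+ 2)%:E * wmeas mu w (ball y (s / 2))))%E).
  apply: lee_sum => y _; apply: le_trans (hF y) _.
  rewrite wvolE// -EFinM lee_fin -mulrA ler_wpM2l//.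
  have -> : s = 2 ^+ 1 * (s / 2) by rewrite expr1; lra.
  by apply: le_trans (dbl 1%N y _ s20) _; rewrite expr1 [2 * _]mulrC mulfK.
rewrite -ge0_sume_distrr => [|y _]; last exact: wmeas_ge0.
apply: lee_wpmul2l; first by rewrite lee_fin mulr_ge0// exprn_ge0.
apply: (@le_trans _ _ (wmeas mu w (ball x (2 * r)))).
  apply: (@sum_disjoint_le _ _ _ (density mu mw w0)) => //.
  - by move=> y; exact: ball_measurable.
  - exact: ball_measurable.
  - by move=> y /tb; rewrite in_ballE => xy; apply: sub_ball; lra.
rewrite wvolE ?mulr_gt0// lee_fin.
by have := dbl 1%N x r r0; rewrite expr1.
Qed.

(** This replaces the differentiation of integrals, at the price of a constant.
    Vitali's lemma inside an open set hardly larger than the part G' of G where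
    F > C L w bounds the integral of F over G' by C L nu(G'), so G' is
    negligible. *)
Lemma small_averages_ae : exists2 C, 1 <= C & forall F r x0 L (G : set X),
  0 < r -> 0 <= L -> measurable_fun setT F -> (forall x, 0 <= F x) ->
  measurable G -> G `<=` ball x0 r ->
  (forall x k, G x -> (wmeas mu F (ball x (r / 2 ^+ k)) <=
      (L * wvol mu w x (r / 2 ^+ k))%:E)%E) ->
  {ae mu, forall x, G x -> F x <= C * L * w x}.
Proof.
have [D D1 dbl] := wvol_doubling mu_dbl wA1.
have D0 : 0 <= D by lra.
exists (D ^+ 3); first exact: exprn_ege1.
move=> F r x0 L G r0 L0 mF F0 mG Gr hG.
pose c := D ^+ 3 * L.
have c0 : 0 <= c by rewrite mulr_ge0// exprn_ge0.
pose h x := Num.max (F x - c * w x) 0.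
have mcw : measurable_fun setT (fun x => c * w x) by exact: measurable_funM.
have cw0 x : 0 <= c * w x by rewrite mulr_ge0.
have mh : measurable_fun setT h.
  apply: measurable_funrpos; exact: measurable_funB.
have h0 x : 0 <= h x by rewrite le_max lexx orbT.
pose G' := G `&` [set x | 0 < h x].
have mG' : measurable G'.
  by apply: measurableI => //; exact: measurable_lt_set.
have G'r : G' `<=` ball x0 r by move=> x [/Gr].
have Ffin : (wmeas mu F G' <= (c%:E * wmeas mu w G'))%E.
  apply/lee_addgt0Pr => e e0.
  pose kappa := mrestr (density mu mw w0) (ball_measurable x0 r).
  have kfin : (kappa setT < +oo)%E.
    by rewrite /kappa /mrestr setTI /density wvolE// ltry.
  have e'0 : 0 < e / (c + 1) by rewrite divr_gt0//; lra.
  have [U [oU G'U] kU] := outer_regular kfin mG' e'0.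
  pose V := U `&` ball x0 r.
  have oV : open V by apply: openI => //; exact: open_metric_ball.
  have mV : measurable V by exact: open_measurable_borel.
  (* e / (c + 1) rather than e / c, as c may vanish *)
  have hV : (wmeas mu w V <= wmeas mu w G' + (e / (c + 1))%:E)%E.
    move: kU; rewrite /kappa /mrestr /density; congr (_ <= wmeas _ _ _ + _)%E.
    by apply/setIidl.
  have /choice[k hk] : forall x, exists k, G' x -> ball x (r / 2 ^+ k.+2) `<=` V.
    move=> x; have [G'x|nG'x] := pselect (G' x); last by exists 0%N.
    have Vx : V x by split; [exact: G'U|exact: G'r].
    move: oV; rewrite openE => /(_ _ Vx); rewrite /interior -nbhs_ballE.
    move=> -[e1 /= e10 h1].
    exists (Num.bound (r / e1)) => _; apply: subset_trans h1; apply: sub_ball.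
    rewrite mdistxx add0r ler_pdivrMr ?exprn_gt0// mulrC -ler_pdivrMr//.
    apply/ltW/(lt_le_trans (upper_nthrootP (leqnn _))).
    by apply: ler_weXn2l; rewrite ?ler1n// ltnW.
  pose rad x := r / 2 ^+ (k x).+2.
  have rad0 x : 0 < rad x by rewrite divr_gt0// exprn_gt0.
  have rad4 x : 4 * rad x = r / 2 ^+ k x.
    rewrite /rad !exprS; have : 2 ^+ k x != 0 :> R by rewrite expf_neq0.
    by move=> ?; field.
  apply: (@le_trans _ _ (c%:E * wmeas mu w V)%E); last first.
    apply: (@le_trans _ _ (c%:E * (wmeas mu w G' + (e / (c + 1))%:E))%E).
      by apply: lee_wpmul2l; rewrite ?lee_fin.
    rewrite ge0_muleDr ?lee_fin ?(ltW e'0)//; last exact: wmeas_ge0.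
    apply: leeD => //; rewrite -EFinM lee_fin mulrCA ger_pMr//.
    by rewrite ler_pdivrMr; lra.
  apply: (@vitali_le _ _ _ mu mu_dbl (density mu mF F0) G' G' rad) => //.
    by move=> x G'x; exists x => //; rewrite in_ballE mdistxx.
  move=> t ut tG' tt.
  apply: (@le_trans _ _ (\sum_(x <- t) c%:E * wmeas mu w (ball x (rad x)))%E).
    rewrite big_seq [leRHS]big_seq; apply: lee_sum => x /tG' G'x.
    apply: (@le_trans _ _ (wmeas mu F (ball x (4 * rad x)))).
      apply: (le_wmeas _ mF F0); last exact: subIsetr.
        by apply: measurableI => //; exact: ball_measurable.
      exact: ball_measurable.
    rewrite rad4; apply: le_trans (hG _ _ G'x.1) _.
    rewrite wvolE// -EFinM lee_fin -rad4 /c.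
    have -> : 4 * rad x = 2 ^+ 2 * rad x by rewrite expr2; ring.
    apply: (@le_trans _ _ (L * (D ^+ 3 * wvol mu w x (rad x)))).
      by apply: ler_wpM2l => //; apply: dbl.
    by rewrite mulrA [L * _]mulrC.
  rewrite -ge0_sume_distrr => [|y _]; last exact: wmeas_ge0.
  apply: lee_wpmul2l; first by rewrite lee_fin.
  apply: (@sum_disjoint_le _ _ _ (density mu mw w0)) => //.
  - by move=> y; exact: ball_measurable.
  - by move=> y /tG' G'y; exact: hk.
have h_neg : wmeas mu h G' = 0%E.
  have wfin : (c%:E * wmeas mu w G')%E \is a fin_num.
    rewrite fin_numM// ge0_fin_numE; last exact: wmeas_ge0.
    apply: (@le_lt_trans _ _ (wmeas mu w (ball x0 r))); last by rewrite wvolE// ltry.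
    by apply: le_wmeas => //; exact: ball_measurable.
  have : (wmeas mu h G' + c%:E * wmeas mu w G' <= c%:E * wmeas mu w G')%E.
    apply: le_trans Ffin; rewrite -wmeasZ// -wmeasD//.
    apply: le_wmeas_fun => //.
    - exact: measurable_funD.
    - by move=> x; rewrite addr_ge0.
    - apply: aeW => x [_ /= hx]; have [F1|F1] := leP (F x - c * w x) 0.
        by move: hx; rewrite /h max_r// ltxx.
      by rewrite /h max_l ?subrK// ltW.
  rewrite -leeBrDr// subee// => h_le; apply/eqP.
  by rewrite eq_le h_le wmeas_ge0.
apply: filterS (wmeas_eq0_ae mh h0 mG' h_neg) => x hx Gx.
rewrite -/c leNgt; apply/negP => Fx.
have hx0 : 0 < h x by rewrite lt_max subr_gt0 Fx.
by move: (hx0); rewrite (hx (conj Gx hx0)) ltxx.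
Qed.

End controlled.

(** * The John-Nirenberg inequality *)

Section john_nirenberg.
Context {R : realType} {d : measure_display} {X : borelMetricType R d}.
Variables (mu : {measure set X -> \bar R}) (mu_dbl : doubling mu).
Variables (m : R) (m_ge2 : 2 <= m) (a : R -> X -> X -> R[i]).
Hypotheses (a_meas : jointly_measurable a) (a_bound : gaussian_bound mu a m).
Hypothesis a_comm : commuting mu a.
Variables (w : X -> R) (wA1 : A1 mu w).
Implicit Types (x y z : X) (r s N L : R) (f : X -> R[i]) (F : X -> R).

Let w0 := weight_ge0 wA1.
Let mw := measurable_weight wA1.

(** The function averaged in the norms over a ball of radius r. *)
Definition osc f r y : R := cabs (f y - opA mu a (r `^ m) f y).

Lemma osc_ge0 f r y : 0 <= osc f r y.
Proof. exact: normc_ge0. Qed.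

Lemma classM_cmeasurable f : classM mu f -> cmeasurable f.
Proof. by move=> [x0 [b [_ [[]]]]]. Qed.

Lemma measurable_osc f r : 0 < r -> classM mu f -> measurable_fun setT (osc f r).
Proof.
move=> r0 fM; have mf := classM_cmeasurable fM.
have rm0 : 0 < r `^ m by exact: powR_gt0.
exact: (measurable_normc (cmeasurableB mf (cmeasurable_opA mu_dbl a_meas rm0 mf))).
Qed.

Definition osc_le f N := forall x r, 0 < r ->
  (wmeas mu (osc f r) (ball x r) <= (N * wvol mu w x r)%:E)%E.

(** The polynomial growth of f on balls is absorbed by the decay of the kernel. *)
Let classM_kernel_lty f r x : 0 < r -> classM mu f ->
  (wmeas mu (fun y => cabs (a (r `^ m) x y) * cabs (f y))%R setT < +oo)%E.
Proof.
move=> r0 fM; have [q [L [L0 hL]]] := classM_growth mu_dbl x r0 fM.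
have [K K0 hK] := kernel_integral_le mu_dbl m_ge2 a_meas a_bound q.
have mf := measurable_normc (classM_cmeasurable fM).
apply: le_lt_trans (hK r x _ L r0 L0 mf (fun y => normc_ge0 _) hL) _.
exact: ltry.
Qed.

(** Doubling of w bounds w(B(x, 2^j r)) by a power of 2^j times w(B(x, r)), so
    that an A_1 weight grows slowly enough for the kernel. *)
Let kernel_controlled_le : exists2 K, 0 < K & forall r x F L, 0 < r -> 0 <= L ->
  measurable_fun setT F -> (forall y, 0 <= F y) ->
  (forall j, (wmeas mu F (ball x (2 ^+ j * r)%R) <=
     (L * wvol mu w x (2 ^+ j * r))%:E)%E) ->
  (wmeas mu (fun y => cabs (a (r `^ m) x y) * F y)%R setT
    <= (K * L * (wvol mu w x r / vol mu x r))%:E)%E.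
Proof.
have [D D1 dbl] := wvol_doubling mu_dbl wA1.
have D0 : 0 <= D by lra.
pose q := Num.bound D; have Dq : D <= 2 ^+ q by apply/ltW/upper_nthrootP.
have [K K0 hK] := kernel_integral_le mu_dbl m_ge2 a_meas a_bound q.
exists (K * D) => [|r x F L r0 L0 mF F0 hF]; first by rewrite mulr_gt0//; lra.
have W0 := wvol_ge0 wA1 x r.
have L'0 : 0 <= L * (D * wvol mu w x r) by rewrite !mulr_ge0.
apply: le_trans (hK r x F _ r0 L'0 mF F0 _) _ => [j|].
  apply: le_trans (hF j) _; rewrite lee_fin -!mulrA; apply: ler_wpM2l => //.
  apply: le_trans (dbl j x r r0) _; rewrite exprS -mulrA; apply: ler_wpM2l => //.
  rewrite mulrC; apply: ler_wpM2l => //.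
  by apply: lerXn2r; rewrite ?nnegrE ?exprn_ge0.
by rewrite lee_fin le_eqVlt; apply/orP; left; apply/eqP; ring.
Qed.

(** In A_s (f - A_r f) - A_r (f - A_s f), up to the m-th powers, the first term
    is governed by the averages of osc f r at scales at least s, which are at
    most L by assumption, and the second by those of osc f s at scales at least
    r, which are O(N) because s <= r. *)
Lemma opA_difference_controlled : exists2 C, 0 < C & forall f N L r s z,
  classM mu f -> 0 <= N -> N <= L -> osc_le f N -> 0 < s -> s <= r ->
  (forall x j, ball z s x -> (wmeas mu (osc f r) (ball x (2 ^+ j * s)%R) <=
     (L * wvol mu w x (2 ^+ j * s))%:E)%E) ->
  {ae mu, forall x, ball z s x -> osc f r x <= osc f s x + C * L * w x}.
Proof.
have [K K0 hK] := kernel_controlled_le.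
have [C1 C11 hC1] := average_larger_scale mu_dbl wA1.
have [Cr Cr0 hCr] := A1_ratio mu_dbl wA1.
exists (2 * (K * Cr) + 2 * (K * C1 * Cr)) => [|f N L r s z fM N0 NL fN s0 sr hL].
  by rewrite addr_gt0// !mulr_gt0//; lra.
have r0 : 0 < r by lra.
have L0 : 0 <= L by lra.
have mor := measurable_osc r0 fM; have mos := measurable_osc s0 fM.
have sub_sr : ball z s `<=` ball z r by apply: sub_ball; rewrite mdistxx; lra.
have diff := opA_difference_le mu_dbl a_meas a_comm s0 r0 fM
  (fun x => classM_kernel_lty x s0 fM) (fun x => classM_kernel_lty x r0 fM).
apply: filterS3 diff (hCr z s s0) (hCr z r r0) => x dx hs hr zx.
have B1 := hK s x (osc f r) L s0 L0 mor (osc_ge0 f r) (fun j => hL x j zx).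
have B2 : (wmeas mu (fun y => cabs (a (r `^ m) x y) * osc f s y)%R setT
    <= (K * (C1 * N) * (wvol mu w x r / vol mu x r))%:E)%E.
  apply: hK => //; [by rewrite mulr_ge0//; lra|exact: osc_ge0|].
  move=> j; apply: (hC1 (osc f s) s N) => //; first exact: osc_ge0.
    by move=> y; exact: fN.
  by apply: (le_trans sr); rewrite ler_peMl ?(ltW r0)// exprn_ege1 ?ler1n.
have {dx} := dx _ _ B1 B2.
have {hs} := hs zx; have {hr} := hr (sub_sr _ zx).
set u := wvol mu w x r / _; set v := wvol mu w x s / _ => hu hv dx.
have h1 : K * L * v <= K * Cr * L * w x.
  have -> : K * Cr * L * w x = K * L * (Cr * w x) by ring.
  by rewrite ler_wpM2l// mulr_ge0// ltW.
have h2 : K * (C1 * N) * u <= K * C1 * Cr * L * w x.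
  apply: (@le_trans _ _ (K * (C1 * N) * (Cr * w x))).
    by rewrite ler_wpM2l// !mulr_ge0//; lra.
  have -> : K * (C1 * N) * (Cr * w x) = (K * C1 * Cr * w x) * N by ring.
  have -> : K * C1 * Cr * L * w x = (K * C1 * Cr * w x) * L by ring.
  by rewrite ler_wpM2l// !mulr_ge0//; lra.
have -> : (2 * (K * Cr) + 2 * (K * C1 * Cr)) * L * w x =
    2 * (K * Cr * L * w x) + 2 * (K * C1 * Cr * L * w x) by ring.
have tri : osc f r x <= osc f s x +
    cabs (opA mu a (s `^ m) f x - opA mu a (r `^ m) f x).
  have triangle (p q t : R[i]) : cabs (p - q) <= cabs (p - t) + cabs (t - q).
    by apply: le_trans (le_normcD _ _); rewrite addrA subrK.
  exact: triangle.
apply: le_trans tri _; rewrite lerD2l; apply: le_trans dx _.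
by apply: lerD; rewrite ler_pM2l.
Qed.

End john_nirenberg.

Section distribution.
Context {R : realType} {d : measure_display} {X : borelMetricType R d}.
Variables (mu : {measure set X -> \bar R}) (mu_dbl : doubling mu).
Variables (m : R) (m_ge2 : 2 <= m) (a : R -> X -> X -> R[i]).
Hypotheses (a_meas : jointly_measurable a) (a_bound : gaussian_bound mu a m).
Hypothesis a_comm : commuting mu a.
Variables (w : X -> R) (wA1 : A1 mu w).
Implicit Types (x y z : X) (r s N L : R) (f : X -> R[i]) (F : X -> R).

Let w0 := weight_ge0 wA1.
Let mw := measurable_weight wA1.
Local Notation osc := (osc mu m a).
Local Notation osc_le := (osc_le mu m a w).

Lemma wmeas_ae_le (A B : set X) : measurable A -> measurable B ->
  {ae mu, forall x, A x -> B x} -> (wmeas mu w A <= wmeas mu w B)%E.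
Proof.
move=> mA mB AB.
have AB0 : wmeas mu w (A `\` B) = 0%E.
  apply/eqP; rewrite eq_le wmeas_ge0// andbT.
  rewrite -[leRHS](mul0e (wmeas mu w (A `\` B))) -wmeasZ//; last exact: measurableD.
  apply: le_wmeas_fun => //.
  - exact: measurable_funM.
  - by move=> x; rewrite mul0r.
  - exact: measurableD.
  - by apply: filterS AB => x h [/h Bx /(_ Bx)].
apply: (@le_trans _ _ (wmeas mu w (B `|` (A `\` B)))).
  apply: le_wmeas => //; first by apply: measurableU => //; exact: measurableD.
  by move=> x Ax; have [Bx|nBx] := pselect (B x); [left|right].
rewrite -[leRHS]adde0 -AB0.
by apply: (@measureU2 _ _ _ (density mu mw w0)) => //; exact: measurableD.
Qed.

(** The stopping radius of x is the largest r / 2^k at which the average of F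
    exceeds B. That k > 2 leaves room to dilate the stopping ball by 4 without
    exceeding r. *)
Let stopping_scale F r B x :
  (forall j, (wmeas mu F (ball x (2 ^+ j * r)%R) <=
     (B * wvol mu w x (2 ^+ j * r))%:E)%E) ->
  (forall k, (k <= 2)%N ->
     (wmeas mu F (ball x (r / 2 ^+ k)%R) <= (B * wvol mu w x (r / 2 ^+ k))%:E)%E) ->
  (exists k, ~ (wmeas mu F (ball x (r / 2 ^+ k)%R) <=
                (B * wvol mu w x (r / 2 ^+ k))%:E)%E) ->
  exists k, [/\ (2 < k)%N,
    ((B * wvol mu w x (r / 2 ^+ k))%:E < wmeas mu F (ball x (r / 2 ^+ k)%R))%E &
    forall i, (0 < i)%N -> (wmeas mu F (ball x (2 ^+ i * (r / 2 ^+ k))%R) <=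
      (B * wvol mu w x (2 ^+ i * (r / 2 ^+ k)))%:E)%E].
Proof.
move=> large small2 [k0 hk0].
pose P k := `[< ~ (wmeas mu F (ball x (r / 2 ^+ k)%R) <=
  (B * wvol mu w x (r / 2 ^+ k))%:E)%E >].
have exP : exists k, P k by exists k0; apply/asboolP.
case: (ex_minnP exP) => k /asboolP Pk kmin; exists k.
have p2 j : 2 ^+ j != 0 :> R by rewrite expf_neq0.
split.
- by rewrite ltnNge; apply/negP => /small2.
- by rewrite ltNge; apply/negP.
- move=> i i0; have [ik|ki] := leqP i k.
    have -> : 2 ^+ i * (r / 2 ^+ k) = r / 2 ^+ (k - i).
      have -> : 2 ^+ k = 2 ^+ i * 2 ^+ (k - i) :> R by rewrite -exprD subnKC.
      by have := p2 (k - i)%N; have := p2 i => ? ?; field; apply/andP.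
    apply: contrapT => h; have : P (k - i)%N by apply/asboolP.
    by move/kmin; rewrite leqNgt ltn_subrL i0 (leq_trans i0 ik).
  have -> : 2 ^+ i * (r / 2 ^+ k) = 2 ^+ (i - k) * r.
    have -> : 2 ^+ i = 2 ^+ k * 2 ^+ (i - k) :> R by rewrite -exprD subnKC// ltnW.
    by have := p2 k => ?; field.
  exact: large.
Qed.

(** By induction on n, for all balls at once. On a ball where the
    average of osc f r first exceeds A N, the operator at scale r may be replaced
    by the one at the scale of that ball up to O(A N w), and the previous step
    applies to the ball; the total mass of the disjoint stopping balls is
    O(1 / A), hence as small a fraction eps as wanted. *)
Lemma osc_distribution_decay eps : 0 < eps -> exists2 T, 0 < T &
  forall f N, classM mu f -> 0 < N -> osc_le f N -> forall n x r, 0 < r ->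
  (wmeas mu w (ball x r `&` [set y | (n%:R * (T * N) * w y < osc f r y)%R])
    <= (eps ^+ n * wvol mu w x r)%:E)%E.
Proof.
move=> eps0.
have [D D1 dbl] := wvol_doubling mu_dbl wA1.
have D0 : 0 <= D by lra.
have [C1 C11 hC1] := average_larger_scale mu_dbl wA1.
have [Cd Cd1 hCd] := small_averages_ae mu_dbl wA1.
have [Co Co0 hCo] := opA_difference_controlled mu_dbl m_ge2 a_meas a_bound a_comm wA1.
have D31 : 1 <= D ^+ 3 by exact: exprn_ege1.
(* C1 * D ^+ 5 / eps makes the stopping balls a fraction eps of the ball, and
   C1 * D ^+ 3 excludes the scales r, r / 2 and r / 4 as well as the larger ones
   from the stopping *)
pose A := C1 * D ^+ 5 / eps + C1 * D ^+ 3.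
have A1' : C1 * D ^+ 5 / eps <= A.
  by rewrite /A lerDl mulr_ge0 ?exprn_ge0//; lra.
have A2' : C1 * D ^+ 3 <= A.
  by rewrite /A lerDr divr_ge0 ?(ltW eps0)// mulr_ge0 ?exprn_ge0//; lra.
have AC1 : C1 <= A by apply: le_trans A2'; rewrite ler_peMr//; lra.
have AD3 : D ^+ 3 <= A by apply: le_trans A2'; rewrite ler_peMl//; lra.
have A0 : 0 < A by lra.
(* the two terms pay for the change of operator on a stopping ball and for the
   points where no stopping occurs *)
pose T := Co * (A * D ^+ 3) + Cd * A.
have T1 : Co * (A * D ^+ 3) <= T by rewrite /T lerDl mulr_ge0//; lra.
have T2 : Cd * A <= T.
  by rewrite /T lerDr mulr_ge0//; [exact: ltW|rewrite mulr_ge0//; lra].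
have T0 : 0 < T by apply: lt_le_trans T2; rewrite mulr_gt0//; lra.
exists T => // f N fM N0 fN; elim=> [|n IH] x0 r r0.
  rewrite expr0 mul1r -wvolE//; apply: (le_wmeas mu mw w0); last by move=> y [].
    apply: measurableI; first exact: ball_measurable.
    apply: measurable_lt_set; first exact: measurable_funM.
    exact: (measurable_osc mu_dbl m a_meas r0 fM).
  exact: ball_measurable.
pose F := osc f r.
have mF : measurable_fun setT F by exact: (measurable_osc mu_dbl m a_meas r0 fM).
have F0 y : 0 <= F y by exact: osc_ge0.
have AN0 : 0 < A * N by exact: mulr_gt0.
have large x j : (wmeas mu F (ball x (2 ^+ j * r)%R) <=
    (A * N * wvol mu w x (2 ^+ j * r))%:E)%E.
  apply: le_trans (hC1 F r N r0 (ltW N0) mF F0 (fun z => fN z r r0) x _ _) _.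
    by rewrite ler_peMl ?(ltW r0)// exprn_ege1 ?ler1n.
  by rewrite lee_fin ler_wpM2r ?wvol_ge0// ler_wpM2r// ltW.
have small2 x k : (k <= 2)%N -> (wmeas mu F (ball x (r / 2 ^+ k)%R) <=
    (A * N * wvol mu w x (r / 2 ^+ k))%:E)%E.
  move=> k2; have p2 : 0 < 2 ^+ k :> R by rewrite exprn_gt0.
  have rk0 : 0 < r / 2 ^+ k by rewrite divr_gt0.
  apply: (@le_trans _ _ (wmeas mu F (ball x r))).
    apply: le_wmeas => //; [exact: ball_measurable..|apply: sub_ball].
    by rewrite mdistxx add0r ler_pdivrMr// ler_peMr ?(ltW r0)// exprn_ege1 ?ler1n.
  apply: le_trans (fN x r r0) _; rewrite lee_fin [A * N]mulrC -mulrA ler_pM2l//.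
  have rE : r = 2 ^+ k * (r / 2 ^+ k) by rewrite mulrC divfK// gt_eqF.
  rewrite {1}rE; apply: le_trans (dbl k x _ rk0) _.
  rewrite ler_wpM2r ?wvol_ge0//; apply: le_trans AD3.
  by apply: ler_weXn2l.
pose S := [set x | ball x0 r x /\ exists k,
  ~ (wmeas mu F (ball x (r / 2 ^+ k)%R) <= (A * N * wvol mu w x (r / 2 ^+ k))%:E)%E].
have /choice[k hk] : forall x, exists k, S x -> [/\ (2 < k)%N,
    ((A * N * wvol mu w x (r / 2 ^+ k))%:E < wmeas mu F (ball x (r / 2 ^+ k)%R))%E &
    forall i, (0 < i)%N -> (wmeas mu F (ball x (2 ^+ i * (r / 2 ^+ k))%R) <=
      (A * N * wvol mu w x (2 ^+ i * (r / 2 ^+ k)))%:E)%E].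
  move=> x; have [[x0x Sx]|nSx] := pselect (S x); last by exists 0%N.
  by have [k hk] := stopping_scale (large x) (small2 x) Sx; exists k.
pose rad x := r / 2 ^+ k x.
have rad0 x : 0 < rad x by rewrite divr_gt0// exprn_gt0.
pose U := \bigcup_(x in S) ball x (rad x).
have mU : measurable U.
  by apply: open_measurable_borel; apply: bigcup_open => x _; exact: open_metric_ball.
pose E := ball x0 r `&` [set y | n.+1%:R * (T * N) * w y < F y].
have mlev q s : 0 < s -> measurable [set y | q * w y < osc f s y].
  move=> s0; apply: measurable_lt_set; first exact: measurable_funM.
  exact: (measurable_osc mu_dbl m a_meas s0 fM).
have mE : measurable E by apply: measurableI; [exact: ball_measurable|exact: mlev].
have EU : (wmeas mu w (E `&` U) <= (eps ^+ n.+1 * wvol mu w x0 r)%:E)%E.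
  pose c := eps ^+ n * D ^+ 3 / (A * N).
  have c0 : 0 <= c by rewrite divr_ge0 ?(ltW AN0)// mulr_ge0// exprn_ge0// ltW.
  apply: (@vitali_le _ _ _ mu mu_dbl (density mu mw w0) _ S rad).
  - exact: measurableI.
  - by move=> x _; exact: rad0.
  - exact: subIsetr.
  move=> t ut tS tt.
  apply: (@le_trans _ _ (\sum_(x <- t) c%:E * wmeas mu F (ball x (rad x)))%E).
    rewrite big_seq [leRHS]big_seq; apply: lee_sum => x /tS Sx.
    have [k3 stop above] := hk x Sx; rewrite -/(rad x) in stop above.
    (* the ball of radius s is the dilated one; the previous step is applied to
       it at its own scale *)
    pose s := 2 ^+ 2 * rad x.
    have s0 : 0 < s by rewrite mulr_gt0// exprn_gt0.
    have sr : s <= r.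
      rewrite /s /rad mulrA ler_pdivrMr ?exprn_gt0// mulrC ler_pM2l//.
      by apply: ler_weXn2l; rewrite ?ler1n// ltnW.
    have ctrl y j : ball x s y -> (wmeas mu F (ball y (2 ^+ j * s)%R) <=
        (A * D ^+ 3 * N * wvol mu w y (2 ^+ j * s))%:E)%E.
      move=> xy; have js0 : 0 < 2 ^+ j * s by rewrite mulr_gt0// exprn_gt0.
      have sj : s <= 2 ^+ j * s by rewrite ler_peMl ?(ltW s0)// exprn_ege1 ?ler1n.
      have bE : 2 ^+ j.+3 * rad x = 2 * (2 ^+ j * s) by rewrite /s !exprS; ring.
      have b0 : 0 < 2 ^+ j.+3 * rad x by rewrite mulr_gt0// exprn_gt0.
      move: xy; rewrite in_ballE => xy.
      apply: (@le_trans _ _ (wmeas mu F (ball x (2 ^+ j.+3 * rad x)))).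
        apply: le_wmeas => //; [exact: ball_measurable..|apply: sub_ball].
        by rewrite bE; lra.
      apply: le_trans (above j.+3 isT) _; rewrite lee_fin.
      have -> : A * D ^+ 3 * N * wvol mu w y (2 ^+ j * s) =
        A * N * (D ^+ 3 * wvol mu w y (2 ^+ j * s)) by ring.
      apply: ler_wpM2l; first exact: ltW.
      apply: le_trans (dbl 2%N y _ js0); apply: le_wvol => //.
        by rewrite mulr_gt0// exprn_gt0.
      by rewrite metric_sym bE expr2; lra.
    have NL : N <= A * D ^+ 3 * N.
      by rewrite ler_peMl ?(ltW N0)// -[leLHS]mulr1 ler_pM//; lra.
    have comp := hCo f N _ r s x fM (ltW N0) NL fN s0 sr ctrl.
    apply: (@le_trans _ _ (eps ^+ n * wvol mu w x s)%:E).
      apply: le_trans (IH x s s0); apply: wmeas_ae_le.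
      - by apply: measurableI; [exact: measurableI|exact: ball_measurable].
      - by apply: measurableI; [exact: ball_measurable|exact: mlev].
      apply: filterS comp => y hy [[[_ /= Fy] _] xy].
      have rs : 4 * rad x = s by rewrite /s expr2; ring.
      rewrite rs in xy; split; first exact: xy.
      change (n%:R * (T * N) * w y < osc f s y); have {hy} := hy xy.
      have : Co * (A * D ^+ 3 * N) * w y <= T * N * w y.
        rewrite ler_wpM2r//; have -> : Co * (A * D ^+ 3 * N) =
          Co * (A * D ^+ 3) * N by ring.
        by rewrite ler_wpM2r// ltW.
      move: Fy; rewrite -natr1 /F.
      by move: (osc f r y) (osc f s y) => p q; move: (n%:R) => u; lra.
    apply: (@le_trans _ _ (c%:E * (A * N * wvol mu w x (rad x))%:E)%E).
      rewrite -EFinM lee_fin /c mulrA divfK ?gt_eqF// -mulrA ler_wpM2l//.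
        by rewrite exprn_ge0// ltW.
      exact: dbl.
    by apply: lee_wpmul2l; rewrite ?lee_fin// ltW.
  rewrite -ge0_sume_distrr => [|y _]; last exact: wmeas_ge0.
  apply: (@le_trans _ _ (c%:E * (C1 * N * (D ^+ 2 * wvol mu w x0 r))%:E)%E).
    apply: lee_wpmul2l; first by rewrite lee_fin.
    apply: (@le_trans _ _ (wmeas mu F (ball x0 (2 * r)))).
      apply: (@sum_disjoint_le _ _ _ (density mu mF F0)) => //.
      - by move=> y; exact: ball_measurable.
      - exact: ball_measurable.
      - move=> y /tS Sy; have [k3 _ _] := hk y Sy; apply: sub_ball.
        have : rad y <= r.
          by rewrite ler_pdivrMr ?exprn_gt0// ler_peMr ?(ltW r0)// exprn_ege1 ?ler1n.
        by move: Sy.1; rewrite in_ballE; lra.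
    have r2 : r <= 2 * r by lra.
    apply: le_trans (hC1 F r N r0 (ltW N0) mF F0 (fun z => fN z r r0) x0 _ r2) _.
    rewrite lee_fin ler_wpM2l//; first by rewrite mulr_ge0//; lra.
    by have := dbl 1%N x0 r r0; rewrite expr1.
  rewrite -EFinM lee_fin /c.
  have -> : eps ^+ n * D ^+ 3 / (A * N) * (C1 * N * (D ^+ 2 * wvol mu w x0 r)) =
      eps ^+ n * wvol mu w x0 r * (C1 * D ^+ 5 / A).
    by rewrite (exprD D 3 2); field; rewrite !gt_eqF.
  have -> : eps ^+ n.+1 * wvol mu w x0 r = eps ^+ n * wvol mu w x0 r * eps.
    by rewrite exprS; ring.
  apply: ler_wpM2l; first by rewrite mulr_ge0 ?exprn_ge0 ?wvol_ge0// ltW.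
  by rewrite ler_pdivrMr// [leRHS]mulrC -ler_pdivrMr.
have EnU : (wmeas mu w (E `\` U) <= 0)%E.
  rewrite -[leRHS](integral_set0 mu (EFin \o w)) -/(wmeas mu w set0).
  apply: wmeas_ae_le; [exact: measurableD|exact: measurable0|].
  have := hCd F r x0 (A * N) (ball x0 r `\` U) r0 (ltW AN0) mF F0.
  move=> /(_ (measurableD (ball_measurable _ _) mU) (@subDsetl _ _ _)) hG.
  have {}hG := hG _; apply: filterS (hG _) => [y hy [[x0y /= Fy] nUy]|x j [x0x nUx]].
    have {hy} := hy (conj x0y nUy); apply/negP; rewrite -ltNge; apply: le_lt_trans Fy.
    apply: ler_wpM2r => //; apply: (@le_trans _ _ (T * N)).
      by rewrite mulrA ler_wpM2r// ltW.
    by rewrite ler_peMl ?ler1n// mulr_ge0// ltW.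
  apply: contrapT => nh; apply: nUx; exists x; last by rewrite in_ballE mdistxx.
  by split => //; exists j.
apply: (@le_trans _ _ (wmeas mu w ((E `&` U) `|` (E `\` U)))).
  by rewrite setUIDK.
apply: (@le_trans _ _ (wmeas mu w (E `&` U) + wmeas mu w (E `\` U))%E).
  apply: (@measureU2 _ _ _ (density mu mw w0)); first exact: measurableI.
  exact: measurableD.
by rewrite -[leRHS]adde0 leeD.
Qed.

End distribution.

(** * Comparison of the norms *)

Section norm_comparison.
Context {R : realType} {d : measure_display} {X : borelMetricType R d}.
Variables (mu : {measure set X -> \bar R}) (mu_dbl : doubling mu).
Variables (m : R) (m_ge2 : 2 <= m) (a : R -> X -> X -> R[i]).
Hypotheses (a_meas : jointly_measurable a) (a_bound : gaussian_bound mu a m).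
Hypothesis a_comm : commuting mu a.
Variables (w : X -> R) (wA1 : A1 mu w).
Implicit Types (x y z : X) (p q r s N L : R) (f : X -> R[i]).

Let w0 := weight_ge0 wA1.
Let mw := measurable_weight wA1.
Local Notation osc := (osc mu m a).
Local Notation osc_le := (osc_le mu m a w).

Definition osc_pow p f r y : R := osc f r y `^ p * w y `^ (1 - p).

Let osc_pow_ge0 p f r y : 0 <= osc_pow p f r y.
Proof. by rewrite mulr_ge0 ?powR_ge0. Qed.

Let measurable_osc_pow p f r : 0 < r -> classM mu f ->
  measurable_fun setT (osc_pow p f r).
Proof.
move=> r0 fM; apply: measurable_funM.
- exact: (measurableT_comp (measurable_powR p) (measurable_osc mu_dbl m a_meas r0 fM)).
- exact: (measurableT_comp (measurable_powR (1 - p)) mw).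
Qed.

(** The bound N of the p-norm, freed from the quotient and the p-th root. *)
Definition osc_pow_le p f N := forall x r, 0 < r ->
  (wmeas mu (osc_pow p f r) (ball x r) <= (N `^ p * wvol mu w x r)%:E)%E.

Lemma BMO_norm_leP p f N : 1 <= p -> 0 <= N ->
  (BMO_norm mu a m w p f <= N%:E)%E <-> osc_pow_le p f N.
Proof.
move=> p1 N0; have p0 : 0 < p by lra.
have pV0 : 0 < p^-1 by rewrite invr_gt0.
have pn0 : p != 0 by rewrite gt_eqF.
split=> [h x r r0|h].
- have W0 := wvol_gt0 mu_dbl wA1 x r0.
  have : (((wvol mu w x r)^-1%:E * wmeas mu (osc_pow p f r) (ball x r)) `^ p^-1
      <= N%:E)%E.
    by apply: le_trans h; apply: ereal_sup_ubound; exists x, r.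
  have : (0 <= wmeas mu (osc_pow p f r) (ball x r))%E.
    by apply: wmeas_ge0 => y; exact: osc_pow_ge0.
  case: (wmeas mu (osc_pow p f r) (ball x r)) => [I|_|//].
  + rewrite lee_fin => I0; rewrite -EFinM poweR_EFin !lee_fin => hI.
    rewrite -ler_pdivrMr// mulrC.
    have q0 : 0 <= (wvol mu w x r)^-1 * I by rewrite mulr_ge0// invr_ge0 ltW.
    rewrite -[leLHS](powRr1 q0) -(mulVf pn0) powRrM.
    by apply: ge0_ler_powR; rewrite ?nnegrE ?powR_ge0// ltW.
  + rewrite gt0_muley ?lte_fin ?invr_gt0// poweRyr ?invr_neq0//.
- apply: ge_ereal_sup => _ [x [r [r0 ->]]].
  have W0 := wvol_gt0 mu_dbl wA1 x r0.
  have {h} := h x r r0.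
  rewrite -/(wvol mu w x r) -/(wmeas mu (osc_pow p f r) (ball x r)).
  have : (0 <= wmeas mu (osc_pow p f r) (ball x r))%E.
    by apply: wmeas_ge0 => y; exact: osc_pow_ge0.
  case: (wmeas mu (osc_pow p f r) (ball x r)) => [I|//|//].
  move=> I0 hI; rewrite lee_fin in I0; rewrite lee_fin -ler_pdivrMr// mulrC in hI.
  rewrite -EFinM poweR_EFin lee_fin -[leRHS](powRr1 N0) -(divff pn0) powRrM.
  have q0 : 0 <= (wvol mu w x r)^-1 * I by rewrite mulr_ge0// invr_ge0 ltW.
  by apply: ge0_ler_powR; rewrite ?nnegrE ?powR_ge0// ltW.
Qed.

(** Where osc > N w one has osc <= N w (osc / (N w))^p, so that the L^p bound
    controls the L^1 one without Hoelder's inequality. *)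
Lemma osc_le_of_osc_pow_le p f N : 1 <= p -> 0 < N -> classM mu f ->
  osc_pow_le p f N -> osc_le f (2 * N).
Proof.
move=> p1 N0 fM h x r r0.
have W0 := wvol_gt0 mu_dbl wA1 x r0.
have mB := ball_measurable x r.
have mo := measurable_osc mu_dbl m a_meas r0 fM.
have mp := measurable_osc_pow p r0 fM.
have Np0 := powR_ge0 N (1 - p).
have m1 : measurable_fun setT (fun y => N * w y) by exact: measurable_funM.
have m2 : measurable_fun setT (fun y => N `^ (1 - p) * osc_pow p f r y).
  exact: measurable_funM.
have n1 y : 0 <= N * w y by rewrite mulr_ge0// ltW.
have n2 y : 0 <= N `^ (1 - p) * osc_pow p f r y.
  by rewrite mulr_ge0//; exact: osc_pow_ge0.
apply: (@le_trans _ _ (wmeas mu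
    (fun y => N * w y + N `^ (1 - p) * osc_pow p f r y)%R (ball x r))).
  apply: (le_wmeas_fun mo (measurable_funD m1 m2) (osc_ge0 _ _ _ _ _) _ mB).
    by move=> y; rewrite addr_ge0.
  apply: filterS (weight_gt0 mu_dbl wA1) => y wy _.
  have [oN|Noo] := leP (osc f r y) (N * w y).
    by apply: le_trans oN _; rewrite lerDl.
  rewrite ler_wpDl// /osc_pow mulrCA -powRM ?(ltW N0)//.
  have Nw0 : 0 < N * w y by exact: mulr_gt0.
  have o0 : 0 < osc f r y by exact: lt_trans Noo.
  rewrite -[leLHS](powRr1 (ltW o0)) -[X in _ `^ X <= _](subrKC p) powRD; last first.
    by rewrite (gt_eqF o0) implybT.
  apply: ler_wpM2l; first exact: powR_ge0.
  rewrite -opprB !powRN lef_pV2 ?posrE ?powR_gt0//.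
  by apply: ge0_ler_powR; rewrite ?nnegrE; [lra|exact: ltW..].
rewrite (wmeasD _ m1 m2 n1 n2 mB) (wmeasZ _ mw w0 mB (ltW N0)).
rewrite (wmeasZ _ mp (osc_pow_ge0 p f r) mB Np0).
apply: (@le_trans _ _ (N%:E * (wvol mu w x r)%:E +
    (N `^ (1 - p))%:E * (N `^ p * wvol mu w x r)%:E)%E).
  rewrite wvolE//; apply: leeD => //; apply: lee_wpmul2l; first by rewrite lee_fin.
  exact: h.
rewrite -!EFinM -EFinD lee_fin mulrA -powRD; last by rewrite (gt_eqF N0) implybT.
rewrite subrK powRr1 ?(ltW N0)//; lra.
Qed.

(** Summation of the layers n T N w < osc <= (n + 1) T N w: the distribution
    function decays like 2^(-n (k + 1)) with k >= q, which beats the factor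
    (n + 1)^q <= 2^(n k). *)
Lemma osc_pow_le_of_osc_le q : 1 <= q -> exists2 C, 0 < C &
  forall f N, classM mu f -> 0 < N -> osc_le f N -> osc_pow_le q f (C * N).
Proof.
move=> q1; have q0 : 0 < q by lra.
pose k := Num.bound q; have qk : q <= k%:R by apply/ltW/archi_boundP/ltW.
have eps0 : 0 < (2 ^+ k.+1)^-1 :> R by rewrite invr_gt0 exprn_gt0.
have [T T0 hT] := osc_distribution_decay mu_dbl m_ge2 a_meas a_bound a_comm wA1 eps0.
exists (2 * T) => [|f N fM N0 fN x r r0]; first by rewrite mulr_gt0.
have W0 := wvol_gt0 mu_dbl wA1 x r0.
have mB := ball_measurable x r.
have mo := measurable_osc mu_dbl m a_meas r0 fM.
have mp := measurable_osc_pow q r0 fM.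
pose S := T * N; have S0 : 0 < S by exact: mulr_gt0.
pose c (n : nat) := (n.+1%:R * S) `^ q.
pose A (n : nat) := ball x r `&` [set y | n%:R * S * w y < osc f r y].
have mA n : measurable (A n).
  apply: measurableI => //; apply: measurable_lt_set => //; exact: measurable_funM.
have layers := @wmeas_layers _ _ _ mu w (osc_pow q f r) c A (ball x r) mp mw
  (osc_pow_ge0 q f r) w0 (fun n => powR_ge0 _ _) mA mB.
apply: le_trans (layers _) _.
  apply: filterS (weight_gt0 mu_dbl wA1) => y wy xy.
  have [osc0|osc0] := leP (osc f r y) 0.
    have oE : osc f r y = 0 by apply/eqP; rewrite eq_le osc0 osc_ge0.
    left; rewrite /osc_pow; rewrite oE.
    by rewrite powR0 ?mul0r// gt_eqF.
  right.
  have Sw0 : 0 < S * w y by exact: mulr_gt0.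
  have ex : exists n, osc f r y <= n.+1%:R * S * w y.
    exists (Num.bound (osc f r y / (S * w y))).
    rewrite -mulrA -ler_pdivrMr//.
    have q2 : 0 <= osc f r y / (S * w y) by rewrite divr_ge0// ltW.
    by apply/ltW/(lt_le_trans (archi_boundP q2)); rewrite ler_nat.
  case: (ex_minnP ex) => n hn nmin; exists n.
    split; first exact: xy.
    change (n%:R * S * w y < osc f r y).
    case: n nmin {hn} => [_|n nmin]; first by rewrite !mul0r.
    by rewrite ltNge; apply/negP => /nmin; rewrite ltnn.
  have b0 : 0 < n.+1%:R * S by rewrite mulr_gt0.
  apply: (@le_trans _ _ ((n.+1%:R * S * w y) `^ q * w y `^ (1 - q))).
    apply: ler_wpM2r; first exact: powR_ge0.
    by apply: ge0_ler_powR; rewrite ?nnegrE ?osc_ge0// ltW// mulr_gt0.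
  rewrite powRM ?(ltW b0)// -mulrA -powRD; last by rewrite (gt_eqF wy) implybT.
  by rewrite addrC subrK powRr1.
pose v := S `^ q * wvol mu w x r.
have v0 : 0 <= v by rewrite mulr_ge0 ?powR_ge0// ltW.
apply: (@le_trans _ _ (\sum_(n <oo) (v / 2 ^+ n)%:E)%E).
  apply: lee_nneseries => [n _|n _].
    by rewrite mule_ge0// ?lee_fin ?powR_ge0//; exact: wmeas_ge0.
  apply: (@le_trans _ _ ((c n)%:E * ((2 ^+ k.+1)^-1 ^+ n * wvol mu w x r)%:E)%E).
    apply: lee_wpmul2l; first by rewrite lee_fin powR_ge0.
    exact: (hT f N fM N0 fN n x r r0).
  rewrite -EFinM lee_fin /c powRM ?ler0n ?(ltW S0)//.
  have n2 : n.+1%:R `^ q <= (2 ^+ n) ^+ k :> R.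
    apply: (@le_trans _ _ ((2 ^+ n) `^ q)).
      apply: ge0_ler_powR; rewrite ?nnegrE ?ler0n ?exprn_ge0 ?(ltW q0)//.
      by rewrite -natrX ler_nat ltn_expl.
    rewrite -[leRHS]powR_mulrn ?exprn_ge0//; apply: ler_powR => //.
    by rewrite exprn_ege1 ?ler1n.
  apply: (@le_trans _ _ ((2 ^+ n) ^+ k * S `^ q * ((2 ^+ k.+1)^-1 ^+ n * wvol mu w x r))).
    apply: ler_wpM2r; first by rewrite mulr_ge0 ?(ltW W0)// exprn_ge0// ltW.
    by apply: ler_wpM2r; first exact: powR_ge0.
  rewrite /v le_eqVlt; apply/orP; left; apply/eqP.
  have e : (2 ^+ k.+1) ^+ n = 2 ^+ n * (2 ^+ n) ^+ k :> R.
    by rewrite exprS exprMn exprAC.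
  rewrite exprVn e.
  have n1 : 2 ^+ n != 0 :> R by rewrite expf_neq0.
  by field; rewrite n1 expf_neq0.
apply: le_trans (sum_geometric v0) _; rewrite lee_fin /v mulrA.
apply: ler_wpM2r; first exact: ltW.
have -> : 2 * T * N = 2 * S by rewrite /S mulrA.
rewrite [leRHS]powRM ?(ltW S0)//; apply: ler_wpM2r; first exact: powR_ge0.
by rewrite -[leLHS](powRr1 (ler0n _ 2)); apply: ler_powR; rewrite ?ler1n.
Qed.

Lemma BMO_norm_transfer p q : 1 <= p -> 1 <= q -> exists2 C, 1 <= C &
  forall f N, classM mu f -> 0 < N -> (BMO_norm mu a m w p f <= N%:E)%E ->
    (BMO_norm mu a m w q f <= (C * N)%:E)%E.
Proof.
move=> p1 q1; have [C C0 hC] := osc_pow_le_of_osc_le q1.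
exists (Num.max 1 (C * 2)) => [|f N fM N0 hN]; first by rewrite le_max lexx.
apply: (@le_trans _ _ (C * (2 * N))%:E).
  have CN0 : 0 <= C * (2 * N) by rewrite !mulr_ge0// ltW.
  apply/(BMO_norm_leP f q1 CN0); apply: hC => //; first by rewrite mulr_gt0.
  by apply: (osc_le_of_osc_pow_le p1 N0 fM); apply/(BMO_norm_leP f p1 (ltW N0)).
by rewrite lee_fin mulrA ler_wpM2r ?(ltW N0)// le_max lexx orbT.
Qed.

Lemma BMO_norm_ge0 p f : (0 <= BMO_norm mu a m w p f)%E.
Proof.
have [x0 _] := A1_inhabited wA1.
apply: (@le_trans _ _ _ _ _ (poweR_ge0 _ _) (ereal_sup_ubound _)).
by exists x0, 1.
Qed.

(** The bound for every N > 0 above the p-norm passes to the limit; a vanishing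
    norm needs this detour. *)
Lemma BMO_norm_le_mul p q : 1 <= p -> 1 <= q -> exists2 C, 1 <= C & forall f,
  classM mu f -> (BMO_norm mu a m w p f < +oo)%E ->
  (BMO_norm mu a m w q f <= C%:E * BMO_norm mu a m w p f)%E.
Proof.
move=> p1 q1; have [C C1 hC] := BMO_norm_transfer p1 q1.
exists C => // f fM; have := BMO_norm_ge0 p f.
case E : (BMO_norm mu a m w p f) => [v|//|//]; rewrite lee_fin => v0 _.
have C0 : 0 < C by lra.
rewrite -EFinM; apply/lee_addgt0Pr => e e0.
have eC : 0 < e / C by exact: divr_gt0.
have -> : ((C * v)%:E + e%:E)%E = (C * (v + e / C))%:E.
  by rewrite -EFinD; congr EFin; field; rewrite gt_eqF.
apply: hC => //; first by rewrite ltr_wpDl.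
by rewrite E lee_fin lerDl ltW.
Qed.

End norm_comparison.

Theorem theorem3p5 (R : realType) (d : measure_display)
    (X : borelMetricType R d) (mu : {measure set X -> \bar R})
    (mu_doubling : doubling mu)
    (m : R) (m_ge2 : 2 <= m)
    (a : R -> X -> X -> R[i])
    (a_meas : jointly_measurable a)
    (a_bound : gaussian_bound mu a m)
    (a_comm : commuting mu a)
    (w : X -> R) (wA1 : A1 mu w) :
  forall p q : R, 1 <= p -> 1 <= q ->
    BMO mu a m w p = BMO mu a m w q /\
    exists2 C : R, 1 <= C & forall f : X -> R[i], BMO mu a m w p f ->
      ((C^-1)%:E * BMO_norm mu a m w q f <= BMO_norm mu a m w p f)%E /\
      (BMO_norm mu a m w p f <= C%:E * BMO_norm mu a m w q f)%E.
Proof.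
move=> p q p1 q1.
have comparison p' q' := @BMO_norm_le_mul R d X mu mu_doubling m m_ge2 a a_meas
  a_bound a_comm w wA1 p' q'.
have [C C1 hC] := comparison p q p1 q1; have [C' C'1 hC'] := comparison q p q1 p1.
have finite_mul (c : R) (u v : \bar R) : (0 <= v -> v < +oo -> u <= c%:E * v ->
    u < +oo)%E.
  by case: v => [v||]// _ _ /le_lt_trans; apply; rewrite -EFinM ltry.
have ge0 p' f : (0 <= BMO_norm mu a m w p' f)%E by exact: BMO_norm_ge0.
have pq f : BMO mu a m w p f -> BMO mu a m w q f.
  move=> [fM fp]; split; first exact: fM.
  exact: finite_mul (ge0 p f) fp (hC f fM fp).
have qp f : BMO mu a m w q f -> BMO mu a m w p f.
  move=> [fM fq]; split; first exact: fM.
  exact: finite_mul (ge0 q f) fq (hC' f fM fq).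
split; first by apply/seteqP; split => f; [exact: pq|exact: qp].
pose K := Num.max C C'; have K1 : 1 <= K by rewrite le_max C1.
have CK : C <= K by rewrite le_max lexx.
have C'K : C' <= K by rewrite le_max lexx orbT.
exists K => // f fp; have [fM fpy] := fp; have [_ fqy] := pq f fp.
split.
- rewrite lee_pdivrMl; last by lra.
  by apply: le_trans (hC f fM fpy) _; rewrite lee_wpmul2r// lee_fin.
- by apply: le_trans (hC' f fM fqy) _; rewrite lee_wpmul2r// lee_fin.
Qed.
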